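(* Let $X_1,\dots,X_n$ be independent random variables with values in $\mathbb{Z}_+$, and suppose that for each $i$ the probability generating function $M_{X_i}$ satisfies $G_{X_i}(z):=M_{X_i}'(z)/M_{X_i}(z)=\sum_{m=0}^\infty a_{i,m+1}z^m$. Let $Y=\sum_{i=1}^nX_i$ and $$\mu=\sum_{i,m}a_{i,m+1},\ \sigma^2=\sum_{i,m}(m+1)a_{i,m+1},\ \mu_2=\sum_{i,m}m\,a_{i,m+1},\ \mu_3=\sum_{i,m}m(m-1)a_{i,m+1}$$ (sums over $1\le i\le n$, $m\ge0$), and assume $\sigma^2>\mu$. Define $\eta_1=\frac32\mu\mu_3-4\mu_2^2$, $\eta_2=27\mu^2\mu_2^2-16\mu_2^3-\frac{27}{2}\mu^3\mu_3+9\mu\mu_2\mu_3$, $\eta_3=\bigl(\frac{\eta_2+\sqrt{4\eta_1^3+\eta_2^2}}{2}\bigr)^{1/3}$, $\eta=2\mu_2+\eta_1/\eta_3-\eta_3$, assuming $\eta,\eta_3$ are positive reals, and set $$\hat p=\frac{3\mu}{3\mu+\eta},\quad \alpha=\Bigl(\mu-\frac{\eta}{3\mu}\Bigr)^2\Big/\Bigl(\mu_2-\frac{\eta^2}{9\mu^2}\Bigr),\quad p=\Bigl(\mu-\frac{\eta}{3\mu}\Bigr)\Big/\Bigl(\sigma^2-\frac{\eta}{3\mu}\Bigl(\frac{\eta}{3\mu}+1\Bigr)\Bigr),$$ with $\alpha>0$, $p,\hat p\in(0,1)$, $q=1-p$, $\hat q=1-\hat p$, and $r=\alpha+1+\frac{\hat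 q-q}{q\hat p}$. Let $V=Z+W$ with $Z\sim\mathrm{NB}(\alpha,p)$ and $W\sim\mathrm{Ge}(\hat p)$ independent. Let $\Psi=\sum_{i=1}^n\xi_i$ with $\xi_i=\min\{\frac12,\,1-d_{TV}(X_i,X_i+1)\}$. If $rq>|\hat q-q|\frac{\hat q}{\hat p^2}$, then $$d_{TV}(Y,V)\le\frac{16}{\Psi\bigl(rq-|\hat q-q|\frac{\hat q}{\hat p^2}\bigr)}\Bigl(\sum_{i=1}^n\sum_{l=1}^\infty\frac{l(l-1)(l-2)}{6}\bigl|a_{i,l+1}-q\,a_{i,l}\bigr|+\frac{|\hat q-q|\hat q^3}{\hat p^4}\Bigr).$$
   Context: $\mathrm{NB}(\alpha,p)$: $\mathbf{P}(Z=m)=\binom{\alpha+m-1}{m}p^\alpha q^m$, $m\ge0$. $\mathrm{Ge}(\hat p)$: $\mathbf{P}(W=x)=\hat q^x\hat p$, $x\ge0$. $d_{TV}(Y,X)=\frac12\sum_{m\ge0}|\mathbf{P}(Y=m)-\mathbf{P}(X=m)|$. The parameters are chosen (in the paper) to match the first three factorial cumulants: $\frac{\alpha q}{p}+\frac{\hat q}{\hat p}=\mu$, $\frac{\alpha q^2}{p^2}+\frac{\hat q^2}{\hat p^2}=\mu_2$, $\frac{\alpha q^3}{p^3}+\frac{\hat q^3}{\hat p^3}=\frac{\mu_3}{2}$. *)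

(* Defs.v *)
From Stdlib Require Import Reals.
From Coquelicot Require Import Coquelicot.
Open Scope R_scope.

Fixpoint sumR (n : nat) (F : nat -> R) : R :=
  match n with O => 0 | S k => sumR k F + F k end.

Definition is_pmf (f : nat -> R) : Prop :=
  (forall k, 0 <= f k) /\ is_series f 1.

(* law of the sum of two independent Z_+-valued r.v.'s (convolution) *)
Definition conv (f g : nat -> R) (k : nat) : R :=
  sumR (S k) (fun j => f j * g (k - j)%nat).

Definition delta0 (k : nat) : R := match k with O => 1 | _ => 0 end.

(* law of X_0 + ... + X_{n-1} for independent X_i with laws f i *)
Fixpoint conv_all (n : nat) (f : nat -> nat -> R) : nat -> R :=
  match n with O => delta0 | S k => conv (conv_all k f) (f k) end.

Definition dTV (f g : nat -> R) : R := / 2 * Series (fun m => Rabs (f m - g m)).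

Definition shift1 (f : nat -> R) (m : nat) : R :=
  match m with O => 0 | S k => f k end.

Definition pgf (f : nat -> R) (z : R) : R := Series (fun k => f k * z ^ k).

Definition logderiv_expansion (f : nat -> R) (a : nat -> R) : Prop :=
  exists d, 0 < d /\ forall z, Rabs z < d ->
    pgf f z <> 0 /\
    is_series (fun m => a (S m) * z ^ m) (Derive (pgf f) z / pgf f z).

Fixpoint rising (al : R) (m : nat) : R :=
  match m with O => 1 | S k => rising al k * (al + INR k) end.

(* generalized binomial coefficient binom(alpha+m-1, m) *)
Definition gbinom (al : R) (m : nat) : R := rising al m / INR (Factorial.fact m).

Definition nb_pmf (al p : R) (m : nat) : R :=
  gbinom al m * Rpower p al * (1 - p) ^ m.

Definition ge_pmf (ph : R) (x : nat) : R := (1 - ph) ^ x * ph.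

(* Main.v *)
(* Identify a law on the nonnegative integers with its generating function, and write D for
   the difference of the laws of Y and V = Z + W.  The recursion for Y gives
   (1 - q X) Y' = (v + b) Y, where v = (1 - q X) G_V, and matching three cumulants (the cubic
   for [eta] is solved by Cardano's formula) makes b vanish to third order at 1, so that
   b = (1 - X)^3 Q with the norm of Q at most the bracket of the bound.  Hence
   (1 - q X) (D' - G_V D) = (1 - X) F with F = (1 - X)^2 Y Q, and the mean of 1 / (N + 1) over
   the number N of fair coins that can be split off from the X_i gives
   ||(1 - X)^2 Y|| <= (16 / 3) / Psi.

   It remains to show ||D|| / 2 <= 3 ||F|| / C, with C = r q - |qh - q| qh / ph^2.  For a pure
   negative binomial target the equation is solved by an explicit kernel whose columns, and
   the cumulative sums of the differences of consecutive columns, have a single positive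
   entry; this bounds their total variation without logarithmic loss.  Writing D = W D1
   reduces to that case, and the factor 1 + (qh / ph) (1 - X) that this puts in front of F is
   absorbed by the smoothness of W.  When this is too weak (which forces ph < p and 1/2 < ph)
   one perturbs around a negative binomial law with parameter qh instead. *)

Require Import Defs.
From Stdlib Require Import Reals Lra Lia FunctionalExtensionality.
From Coquelicot Require Import Coquelicot.
Open Scope R_scope.

(** Division by [W] costs the factor [(1 - qh X) / ph], of norm [(1 + qh) / ph], which a bound
    uniform in [ph] cannot afford. Written as [1 + m (1 - X)] with [m = qh / ph], its large part is
    a difference, and it is never estimated: summation by parts carries it through the kernel to the
    output side, where multiplying back by [W] meets [(1 - X) W], of norm at most [2 ph]. Only the
    factor [1 + 2 qh <= 3] survives. The negative entries of a kernel column never outweigh its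
    positive one, so the norm of the column is at most twice that entry, which in turn is at most
    the reciprocal of a Stein weight [lam + q m]. In the perturbation argument the norm of [D]
    appears on both sides. The inequality always holds, but it is informative only where the factor
    left in front of [D] is large enough, and it is used exactly where the first bound fails. The
    constant 16 is [3 * (16 / 3)]: 3 bounds [1 + 2 qh], and 16/3 comes from the size of central
    binomial weights. *)

(** * Finite sums, and series as limits of finite sums *)

Lemma sumR_ext n F G :
  (forall i, (i < n)%nat -> F i = G i) -> sumR n F = sumR n G.
Proof.
  induction n as [|n IH]; intros H; simpl; [reflexivity|].
  rewrite IH, (H n); auto.
Qed.

Lemma sumR_le n F G :
  (forall i, (i < n)%nat -> F i <= G i) -> sumR n F <= sumR n G.
Proof.
  induction n as [|n IH]; intros H; simpl; [lra|].
  apply Rplus_le_compat; auto.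
Qed.

Lemma sumR_zero n : sumR n (fun _ => 0) = 0.
Proof. induction n as [|n IH]; simpl; lra. Qed.

Lemma sumR_ge0 n F : (forall i, (i < n)%nat -> 0 <= F i) -> 0 <= sumR n F.
Proof. intros H. rewrite <- (sumR_zero n). now apply sumR_le. Qed.

Lemma sumR_plus n F G : sumR n (fun i => F i + G i) = sumR n F + sumR n G.
Proof. induction n as [|n IH]; simpl; lra. Qed.

Lemma sumR_scal n c F : sumR n (fun i => c * F i) = c * sumR n F.
Proof. induction n as [|n IH]; simpl; [|rewrite IH]; ring. Qed.

Lemma sumR_head n F : sumR (S n) F = F O + sumR n (fun i => F (S i)).
Proof.
  induction n as [|n IH]; [simpl; ring|].
  change (sumR (S (S n)) F) with (sumR (S n) F + F (S n)).
  rewrite IH. simpl. ring.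
Qed.

Lemma sumR_incr F n m :
  (forall i, 0 <= F i) -> (n <= m)%nat -> sumR n F <= sumR m F.
Proof.
  intros H Hm. induction Hm as [|m Hm IH]; simpl; [lra|].
  specialize (H m). lra.
Qed.

Lemma Rabs_sumR n F : Rabs (sumR n F) <= sumR n (fun i => Rabs (F i)).
Proof.
  induction n as [|n IH]; simpl; [rewrite Rabs_R0; lra|].
  eapply Rle_trans; [apply Rabs_triang|]. lra.
Qed.

Lemma sum_n_sumR F n : sum_n F n = sumR (S n) F.
Proof.
  induction n as [|n IH].
  - rewrite sum_O. simpl. symmetry. apply Rplus_0_l.
  - rewrite sum_Sn, IH. reflexivity.
Qed.

Lemma is_series_sumR_lim F l :
  is_series F l <-> is_lim_seq (fun n => sumR n F) l.
Proof.
  rewrite (is_lim_seq_incr_1 (fun n => sumR n F)).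
  split; intros H.
  - apply is_lim_seq_ext with (2 := H). intros n. apply sum_n_sumR.
  - unfold is_series. apply (is_lim_seq_ext (fun n => sumR (S n) F) (sum_n F)) with (2 := H).
    intros n. symmetry; apply sum_n_sumR.
Qed.

Lemma is_series_shift1 g l : is_series g l -> is_series (shift1 g) l.
Proof.
  intros Hg. apply is_series_sumR_lim, is_lim_seq_incr_1.
  apply is_series_sumR_lim in Hg. apply is_lim_seq_ext with (2 := Hg).
  intros n. rewrite sumR_head. symmetry. apply Rplus_0_l.
Qed.

Lemma series_ge0_bounded F M :
  (forall i, 0 <= F i) -> (forall n, sumR n F <= M) ->
  ex_series F /\ Series F <= M.
Proof.
  intros H0 HM.
  assert (Hf : ex_finite_lim_seq (fun n => sumR n F)).
  { apply ex_finite_lim_seq_incr with M; auto.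
    intros n. simpl. specialize (H0 n). lra. }
  destruct Hf as [l Hl].
  assert (Hs : is_series F l) by now apply is_series_sumR_lim.
  split; [now exists l|].
  rewrite (is_series_unique _ _ Hs).
  apply (is_lim_seq_le _ _ l M HM Hl (is_lim_seq_const M)).
Qed.

Lemma sumR_le_is_series F l n :
  (forall i, 0 <= F i) -> is_series F l -> sumR n F <= l.
Proof.
  intros H0 Hs. apply is_series_sumR_lim in Hs.
  apply (is_lim_seq_incr_compare _ l Hs).
  intros k. simpl. specialize (H0 k). lra.
Qed.

Lemma sumR_le_Series F n :
  (forall i, 0 <= F i) -> ex_series F -> sumR n F <= Series F.
Proof. intros H0 Hs. apply sumR_le_is_series; auto. now apply Series_correct. Qed.

Lemma Series_sumR n (F : nat -> nat -> R) :
  (forall i, (i < n)%nat -> ex_series (F i)) ->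
  is_series (fun l => sumR n (fun i => F i l)) (sumR n (fun i => Series (F i))).
Proof.
  induction n as [|n IH]; intros H; simpl.
  - apply is_series_sumR_lim.
    apply is_lim_seq_ext with (fun _ => 0); [|apply is_lim_seq_const].
    intros k. now rewrite sumR_zero.
  - apply @is_series_plus; [apply IH; auto | apply Series_correct; auto].
Qed.

(** * Formal power series and absolutely summable sequences *)

Definition padd (f g : nat -> R) k := f k + g k.
Definition popp (f : nat -> R) k := - f k.
Definition psub (f g : nat -> R) k := f k - g k.
Definition pzero (k : nat) := 0.
Definition pC (c : R) (k : nat) := match k with O => c | _ => 0 end.
Definition pX : nat -> R := shift1 delta0.
Definition pderiv (f : nat -> R) k := (INR k + 1) * f (S k).

Declare Scope fps_scope.
Delimit Scope fps_scope with fps.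
Infix "+" := padd : fps_scope.
Infix "-" := psub : fps_scope.
Infix "*" := conv : fps_scope.
Notation "- f" := (popp f) : fps_scope.
Notation "1" := delta0 : fps_scope.

Lemma conv_head f g k :
  conv f g (S k) = f O * g (S k) + conv (fun i => f (S i)) g k.
Proof. unfold conv. rewrite sumR_head. reflexivity. Qed.

Lemma conv_last f g k :
  conv f g (S k) = conv f (fun i => g (S i)) k + f (S k) * g O.
Proof.
  unfold conv. change (sumR (S (S k)) ?F) with (sumR (S k) F + F (S k)).
  cbv beta. rewrite Nat.sub_diag. f_equal.
  apply sumR_ext. intros i Hi. f_equal. f_equal. lia.
Qed.

Lemma conv_0 f g : conv f g O = f O * g O.
Proof. unfold conv. simpl. ring. Qed.

Lemma conv_plus_l f g h k : conv (padd f g) h k = conv f h k + conv g h k.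
Proof.
  unfold conv. rewrite <- sumR_plus. apply sumR_ext. intros. unfold padd. ring.
Qed.

Lemma conv_scal_l c f h k : conv (fun i => c * f i) h k = c * conv f h k.
Proof.
  unfold conv. rewrite <- sumR_scal. apply sumR_ext. intros. ring.
Qed.

Lemma conv_comm f g : conv f g = conv g f.
Proof.
  apply functional_extensionality. intros k. revert f g.
  induction k as [|k IH]; intros f g; [rewrite !conv_0; ring|].
  rewrite conv_head, conv_last, IH. ring.
Qed.

Lemma conv_assoc f g h : conv f (conv g h) = conv (conv f g) h.
Proof.
  apply functional_extensionality. intros k. revert f.
  induction k as [|k IH]; intros f; [rewrite !conv_0; ring|].
  rewrite (conv_head f), (conv_head (conv f g)), IH, conv_0.
  replace (fun i => conv f g (S i))
    with (padd (fun i => f O * g (S i)) (conv (fun i => f (S i)) g)).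
  2:{ apply functional_extensionality; intros i. unfold padd. now rewrite conv_head. }
  rewrite conv_plus_l, conv_scal_l, (conv_head g h). ring.
Qed.

Lemma conv_C c f : conv (pC c) f = (fun k => c * f k).
Proof.
  apply functional_extensionality. intros [|k]; [apply conv_0|].
  rewrite conv_head. simpl.
  replace (conv (fun _ => 0) f k) with 0; [ring|].
  symmetry. etransitivity; [|apply (sumR_zero (S k))].
  apply sumR_ext. intros; ring.
Qed.

Lemma pC_1 : pC 1 = delta0.
Proof. apply functional_extensionality. now intros [|k]. Qed.

Lemma conv_1_l f : conv delta0 f = f.
Proof.
  rewrite <- pC_1, conv_C. apply functional_extensionality. intros; ring.
Qed.

Lemma conv_X f : conv pX f = shift1 f.
Proof.
  apply functional_extensionality. intros [|k].
  - rewrite conv_0. simpl. ring.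
  - rewrite conv_head. change (fun i => pX (S i)) with delta0.
    rewrite conv_1_l. unfold pX. simpl. ring.
Qed.

(** Registering convolution as a commutative ring lets [ring] prove every generating function
    identity below; inverses such as [geom] enter only by rewriting with [geom_inv]. *)
Lemma fps_ring :
  ring_theory pzero delta0 padd conv psub popp (@eq (nat -> R)).
Proof.
  split; intros; try (apply functional_extensionality; intros k;
    unfold padd, popp, psub, pzero; ring).
  - apply conv_1_l.
  - apply conv_comm.
  - apply conv_assoc.
  - apply functional_extensionality; intros k. apply conv_plus_l.
Qed.
Add Ring fps : fps_ring.

Lemma pC_plus a b : pC (a + b) = (pC a + pC b)%fps.
Proof. apply functional_extensionality. intros [|k]; unfold padd; simpl; ring. Qed.

Lemma pC_minus a b : pC (a - b) = (pC a - pC b)%fps.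
Proof. apply functional_extensionality. intros [|k]; unfold psub; simpl; ring. Qed.

Lemma pC_mult a b : pC (a * b) = (pC a * pC b)%fps.
Proof.
  rewrite conv_C. apply functional_extensionality. intros [|k]; simpl; ring.
Qed.

Lemma pderiv_minus f g : pderiv (f - g)%fps = (pderiv f - pderiv g)%fps.
Proof. apply functional_extensionality; intros k; unfold pderiv, psub; ring. Qed.

Lemma pderiv_C c : pderiv (pC c) = pzero.
Proof. apply functional_extensionality; intros k; unfold pderiv, pzero; simpl; ring. Qed.

Lemma pderiv_X : pderiv pX = 1%fps.
Proof. apply functional_extensionality; intros [|k]; unfold pderiv; simpl; ring. Qed.

(** In each term of the product the degree [k + 1] splits as [j + (k + 1 - j)], one part for each
    factor. *)
Lemma pderiv_mult f g : pderiv (f * g)%fps = (pderiv f * g + f * pderiv g)%fps.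
Proof.
  apply functional_extensionality. intros k. unfold pderiv at 1, padd.
  transitivity (sumR (S (S k)) (fun j => (INR j * f j) * g (S k - j)%nat)
    + sumR (S (S k)) (fun j => f j * (INR (S k - j) * g (S k - j)%nat))).
  - unfold conv. rewrite <- sumR_scal, <- sumR_plus. apply sumR_ext.
    intros j Hj. rewrite <- S_INR.
    replace (INR (S k)) with (INR j + INR (S k - j)); [ring|].
    rewrite <- plus_INR. f_equal. lia.
  - f_equal.
    + rewrite sumR_head. simpl INR at 1. unfold conv. ring_simplify.
      apply sumR_ext. intros j Hj. unfold pderiv. now rewrite <- S_INR.
    + change (sumR (S (S k)) ?F) with (sumR (S k) F + F (S k)). cbv beta.
      rewrite Nat.sub_diag. simpl (INR 0). unfold conv. ring_simplify.
      apply sumR_ext. intros j Hj. unfold pderiv. rewrite <- S_INR.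
      replace (S k - j)%nat with (S (k - j)) by lia. ring.
Qed.

(** * The norm of absolutely summable sequences *)

Definition l1 (f : nat -> R) := ex_series (fun k => Rabs (f k)).
Definition norm1 (f : nat -> R) := Series (fun k => Rabs (f k)).

Lemma l1_ex_series f : l1 f -> ex_series f.
Proof. apply ex_series_Rabs. Qed.

Lemma l1_bounded f M :
  (forall n, sumR n (fun k => Rabs (f k)) <= M) -> l1 f /\ norm1 f <= M.
Proof. intros H. apply series_ge0_bounded; auto. intros; apply Rabs_pos. Qed.

Lemma sumR_le_norm1 f n : l1 f -> sumR n (fun k => Rabs (f k)) <= norm1 f.
Proof. intros H. apply sumR_le_Series; auto. intros; apply Rabs_pos. Qed.

Lemma norm1_ge0 f : l1 f -> 0 <= norm1 f.
Proof. intros H. apply (sumR_le_norm1 f O H). Qed.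

Lemma l1_plus f g : l1 f -> l1 g -> l1 (f + g)%fps /\ norm1 (f + g)%fps <= norm1 f + norm1 g.
Proof.
  intros Hf Hg. apply l1_bounded. intros n.
  apply Rle_trans with (sumR n (fun k => Rabs (f k) + Rabs (g k))).
  - apply sumR_le. intros; apply Rabs_triang.
  - rewrite sumR_plus. apply Rplus_le_compat; now apply sumR_le_norm1.
Qed.

Lemma l1_C_mult c f : l1 f -> l1 (pC c * f)%fps /\ norm1 (pC c * f)%fps <= Rabs c * norm1 f.
Proof.
  intros Hf. rewrite conv_C. apply l1_bounded. intros n.
  rewrite (sumR_ext n _ (fun k => Rabs c * Rabs (f k))) by (intros; apply Rabs_mult).
  rewrite sumR_scal. apply Rmult_le_compat_l; [apply Rabs_pos|].
  now apply sumR_le_norm1.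
Qed.

Lemma psub_padd f g : (f - g)%fps = (f + pC (-1) * g)%fps.
Proof. rewrite conv_C. apply functional_extensionality; intros k; unfold psub, padd; ring. Qed.

Lemma l1_minus f g : l1 f -> l1 g -> l1 (f - g)%fps /\ norm1 (f - g)%fps <= norm1 f + norm1 g.
Proof.
  intros Hf Hg. rewrite psub_padd.
  destruct (l1_C_mult (-1) g Hg) as [H1 H2].
  destruct (l1_plus _ _ Hf H1) as [H3 H4]. split; auto.
  replace (Rabs (-1)) with 1 in H2 by (rewrite Rabs_left; lra). lra.
Qed.

Lemma is_series_conv f g a b :
  is_series f a -> is_series g b -> l1 f -> l1 g -> is_series (f * g)%fps (a * b).
Proof.
  intros Hf Hg Lf Lg.
  apply is_series_ext with (2 := is_series_mult f g a b Hf Hg Lf Lg).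
  intros n. unfold conv. rewrite <- sum_n_Reals, sum_n_sumR. reflexivity.
Qed.

Lemma l1_mult f g : l1 f -> l1 g -> l1 (f * g)%fps /\ norm1 (f * g)%fps <= norm1 f * norm1 g.
Proof.
  intros Hf Hg.
  assert (Hs : is_series (conv (fun k => Rabs (f k)) (fun k => Rabs (g k)))
                 (norm1 f * norm1 g)).
  { apply is_series_conv; try (now apply Series_correct);
    [eapply ex_series_ext with (2 := Hf) | eapply ex_series_ext with (2 := Hg)];
    intros; simpl; now rewrite Rabs_Rabsolu. }
  apply l1_bounded. intros n.
  apply Rle_trans with (sumR n (conv (fun k => Rabs (f k)) (fun k => Rabs (g k)))).
  - apply sumR_le. intros i _. unfold conv.
    eapply Rle_trans; [apply Rabs_sumR|]. apply Req_le, sumR_ext.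
    intros; apply Rabs_mult.
  - apply sumR_le_is_series; auto. intros i. apply sumR_ge0. intros.
    apply Rmult_le_pos; apply Rabs_pos.
Qed.

Lemma l1_ge0 f l : (forall k, 0 <= f k) -> is_series f l -> l1 f /\ norm1 f = l.
Proof.
  intros H0 Hs.
  assert (H : is_series (fun k => Rabs (f k)) l).
  { apply is_series_ext with (2 := Hs). intros. now rewrite Rabs_pos_eq. }
  split; [now exists l | now apply is_series_unique].
Qed.

Lemma is_series_finite f N :
  (forall k, (N <= k)%nat -> f k = 0) -> is_series f (sumR N f).
Proof.
  intros H. apply is_series_sumR_lim.
  apply is_lim_seq_incr_n with N.
  apply is_lim_seq_ext with (fun _ => sumR N f); [|apply is_lim_seq_const].
  induction n as [|n IH]; [reflexivity|]. simpl. rewrite <- IH, H by lia. ring.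
Qed.

Lemma is_series_C c : is_series (pC c) c.
Proof.
  replace c with (sumR 1 (pC c)) at 2 by (simpl; ring).
  apply is_series_finite. intros [|k] Hk; [lia|reflexivity].
Qed.

Lemma l1_C c : l1 (pC c) /\ norm1 (pC c) <= Rabs c.
Proof.
  apply l1_bounded. intros n. induction n as [|[|n] IH]; simpl in *.
  - apply Rabs_pos.
  - lra.
  - rewrite Rabs_R0 in *. lra.
Qed.

Lemma is_series_X : is_series pX 1.
Proof.
  replace 1 with (sumR 2 pX) by (unfold pX; simpl; ring).
  apply is_series_finite. intros [|[|k]] Hk; try lia. reflexivity.
Qed.

Lemma pX_ge0 k : 0 <= pX k.
Proof. destruct k as [|[|k]]; unfold pX; simpl; lra. Qed.

Lemma l1_X : l1 pX.
Proof. apply l1_ge0 with 1; [apply pX_ge0 | apply is_series_X]. Qed.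

Lemma l1_one : l1 1%fps.
Proof. rewrite <- pC_1. apply l1_C. Qed.

(** * The Stein kernel of the negative binomial law *)

Section Stein_kernel.
Context (q lam : R) (pi : nat -> R).
Context (q_pos : 0 < q) (q_lt1 : q < 1) (lam_pos : 0 < lam).
Context (pi_pos : forall j, 0 < pi j).
Context (pi_rec : forall j, (INR j + 1) * pi (S j) = (lam + q * INR j) * pi j).
Context (pi_sum : is_series pi 1).

(* [- pi j * H] and [pi j * G] are the two branches of the solution of the Stein equation for
   the indicator of [j]; both are junk at [m = 0], where only [m * H m] is used. *)
Let w (m : nat) := lam + q * INR m.
Let L (m : nat) := sumR m pi.
Let Rt (m : nat) := 1 - L m.
Let H (m : nat) := L m / (INR m * pi m).
Let G (m : nat) := Rt m / (INR m * pi m).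
Let A (k : nat) := G (S k) - G (S (S k)).
Let B (k : nat) := H (S (S k)) - H (S k).
(** Up to a common positive denominator, [T] and [tau] are the increments of [H] and the decrements
    of [G]; see [B_eq] and [A_eq]. *)
Let T (m : nat) := INR m * L (S m) - w m * L m.
Let tau (m : nat) := w m * Rt m - INR m * Rt (S m).

Local Lemma w_pos m : 0 < w m.
Proof. unfold w. pose proof (pos_INR m). nra. Qed.

Local Lemma L_S m : L (S m) = L m + pi m.
Proof. reflexivity. Qed.

Local Lemma L_ge0 m : 0 <= L m.
Proof. apply sumR_ge0. intros; left; auto. Qed.

(** The recursion for [pi] removes all point masses from the increment. Hence [T] is [1 - q] times a
    sum of values of [L], which gives both its sign and the summation formula [sum_L]. *)
Local Lemma T_S m : T (S m) = T m + (1 - q) * L (S m).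
Proof.
  unfold T, w. rewrite !L_S, S_INR. pose proof (pi_rec m). simpl in *. lra.
Qed.

Local Lemma T_ge0 m : 0 <= T m.
Proof.
  induction m as [|m IH].
  - unfold T, w, L. simpl. lra.
  - rewrite T_S. pose proof (L_ge0 (S m)). nra.
Qed.

(* This is the convexity of [H]. *)
Local Lemma T2_ge0 m : 0 <= INR m * T (S m) - w (S m) * T m.
Proof.
  induction m as [|m IH].
  - unfold T at 2, w, L. simpl. pose proof (T_ge0 1). lra.
  - pose proof (T_ge0 m). pose proof (T_ge0 (S m)).
    pose proof (T_S m) as E1. pose proof (T_S (S m)) as E2.
    replace (INR (S m) * T (S (S m)) - w (S (S m)) * T (S m))
      with (INR m * T (S m) - w (S m) * T m + 2 * (1 - q) * T (S m)); [nra|].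
    assert (E3 : T (S m) = (INR m + 1) * L (S (S m)) - w (S m) * L (S m))
      by (unfold T; rewrite S_INR; ring).
    assert (E4 : w (S (S m)) = w (S m) + q) by (unfold w; rewrite !S_INR; ring).
    rewrite E2, E4, (S_INR m). replace (T m) with (T (S m) - (1 - q) * L (S m)) by lra.
    nra.
Qed.

Local Lemma pi_ratio j : pi (S j) = (lam + q * INR j) * pi j / (INR j + 1).
Proof. pose proof (pos_INR j). rewrite <- pi_rec. field. lra. Qed.

Local Lemma tail_series m : is_series (fun i => pi (m + i)%nat) (Rt m).
Proof.
  unfold Rt, L. destruct m as [|m].
  - simpl. rewrite Rminus_0_r. exact pi_sum.
  - rewrite <- sum_n_sumR.
    apply (is_series_incr_n pi (S m)); [lia|].
    simpl Nat.pred.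
    match goal with |- is_series _ ?l => replace l with 1; [exact pi_sum|] end.
    change (@eq R 1 (1 - sum_n pi m + sum_n pi m)). ring.
Qed.

Local Lemma Rt_ge0 m : 0 <= Rt m.
Proof.
  rewrite <- (is_series_unique _ _ (tail_series m)).
  apply (sumR_le_Series _ O); [intros; left; auto | eexists; apply tail_series].
Qed.

Local Lemma is_series_ge0 F l : is_series F l -> (forall i, 0 <= F i) -> 0 <= l.
Proof. intros Hs Hi. apply (sumR_le_is_series F l O Hi Hs). Qed.

(** Both tails are series over the same index [i], and the combination is nonnegative term by term
    by the ratio of consecutive masses. *)
Local Lemma tau_ge0 m : 0 <= tau m.
Proof.
  apply is_series_ge0 with
    (fun i => plus (scal (w m) (pi (m + i)%nat)) (scal (- INR m) (pi (S m + i)%nat))).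
  - replace (tau m) with (plus (scal (w m) (Rt m)) (scal (- INR m) (Rt (S m))))
      by (unfold tau, plus, scal; simpl; unfold mult; simpl; ring).
    apply @is_series_plus; apply @is_series_scal; apply tail_series.
  - intros i. unfold plus, scal; simpl; unfold mult; simpl.
    rewrite pi_ratio. rewrite plus_INR.
    pose proof (pos_INR m). pose proof (pos_INR i). pose proof (pi_pos (m + i)).
    replace (w m * pi (m + i)%nat +
      - INR m * ((lam + q * (INR m + INR i)) * pi (m + i)%nat / (INR m + INR i + 1)))
    with (pi (m + i)%nat / (INR m + INR i + 1) *
       (lam * (INR i + 1) + q * INR m)).
    2:{ unfold w. field. lra. }
    apply Rmult_le_pos; [|nra].
    apply Rdiv_le_0_compat; lra.
Qed.

(* This is the convexity of [G], and holds term by term in the tail sums. *)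
Local Lemma tau2_ge0 m : 0 <= w (S m) * tau m - INR m * tau (S m).
Proof.
  apply is_series_ge0 with
    (fun i => plus (scal (w m * w (S m)) (pi (m + i)%nat))
       (plus (scal (- 2 * INR m * w (S m)) (pi (S m + i)%nat))
             (scal (INR m * (INR m + 1)) (pi (S (S m) + i)%nat)))).
  - replace (w (S m) * tau m - INR m * tau (S m)) with
     (plus (scal (w m * w (S m)) (Rt m))
       (plus (scal (- 2 * INR m * w (S m)) (Rt (S m)))
             (scal (INR m * (INR m + 1)) (Rt (S (S m)))))).
    2:{ change (w m * w (S m) * Rt m + (- 2 * INR m * w (S m) * Rt (S m)
          + INR m * (INR m + 1) * Rt (S (S m))) = w (S m) * tau m - INR m * tau (S m)).
        unfold tau. rewrite S_INR. ring. }
    repeat apply @is_series_plus; apply @is_series_scal; apply tail_series.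
  - intros i. change (0 <= w m * w (S m) * pi (m + i)%nat
      + (- 2 * INR m * w (S m) * pi (S (m + i))
         + INR m * (INR m + 1) * pi (S (S (m + i))))).
    rewrite !pi_ratio. rewrite S_INR, plus_INR.
    pose proof (pos_INR m). pose proof (pos_INR i). pose proof (pi_pos (m + i)).
    unfold w. rewrite S_INR.
    set (x := INR m) in *. set (y := INR i) in *. set (z := pi (m + i)%nat) in *.
    match goal with |- 0 <= ?a => replace a with
      (z / ((x + y + 1) * (x + y + 2)) *
       (lam ^ 2 * (y ^ 2 + 3 * y + 2)
        + lam * q * (4 * x * y + 4 * x + y ^ 2 + 3 * y + 2) + q ^ 2 * (2 * x * (x + 1)))) end.
    + apply Rmult_le_pos; [apply Rdiv_le_0_compat; nra | ].
      repeat apply Rplus_le_le_0_compat; repeat apply Rmult_le_pos; nra.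
    + field. lra.
Qed.

Local Lemma A_eq k : A k = tau (S k) / (INR (S k) * w (S k) * pi (S k)).
Proof.
  unfold A, G, tau. rewrite (pi_ratio (S k)). fold (w (S k)).
  rewrite (S_INR (S k)). pose proof (pos_INR k). pose proof (w_pos (S k)).
  pose proof (pi_pos (S k)). rewrite S_INR. field. repeat split; lra.
Qed.

Local Lemma B_eq k : B k = T (S k) / (INR (S k) * w (S k) * pi (S k)).
Proof.
  unfold B, H, T. rewrite (pi_ratio (S k)). fold (w (S k)).
  rewrite (S_INR (S k)). pose proof (pos_INR k). pose proof (w_pos (S k)).
  pose proof (pi_pos (S k)). rewrite S_INR. field. repeat split; lra.
Qed.

Local Lemma den_pos k : 0 < INR (S k) * w (S k) * pi (S k).
Proof.
  repeat apply Rmult_lt_0_compat; auto using w_pos.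
  apply lt_0_INR; lia.
Qed.

Local Lemma A_ge0 k : 0 <= A k.
Proof.
  rewrite A_eq. apply Rdiv_le_0_compat; [apply tau_ge0 | apply den_pos].
Qed.

Local Lemma B_ge0 k : 0 <= B k.
Proof.
  rewrite B_eq. apply Rdiv_le_0_compat; [apply T_ge0 | apply den_pos].
Qed.

Local Lemma A_decr k : 0 <= A k - A (S k).
Proof.
  replace (A k - A (S k)) with
    ((w (S (S k)) * tau (S k) - INR (S k) * tau (S (S k)))
       / (INR (S k) * w (S k) * pi (S k) * w (S (S k)))).
  - apply Rdiv_le_0_compat; [apply tau2_ge0 |].
    apply Rmult_lt_0_compat; [apply den_pos | apply w_pos].
  - rewrite !A_eq, (pi_ratio (S k)). fold (w (S k)). rewrite (S_INR (S k)).
    pose proof (pos_INR k). pose proof (w_pos (S k)). pose proof (w_pos (S (S k))).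
    pose proof (pi_pos (S k)). rewrite (S_INR k). field. repeat split; lra.
Qed.

Local Lemma B_incr k : 0 <= B (S k) - B k.
Proof.
  replace (B (S k) - B k) with
    ((INR (S k) * T (S (S k)) - w (S (S k)) * T (S k))
       / (INR (S k) * w (S k) * pi (S k) * w (S (S k)))).
  - apply Rdiv_le_0_compat; [apply T2_ge0 |].
    apply Rmult_lt_0_compat; [apply den_pos | apply w_pos].
  - rewrite !B_eq, (pi_ratio (S k)). fold (w (S k)). rewrite (S_INR (S k)).
    pose proof (pos_INR k). pose proof (w_pos (S k)). pose proof (w_pos (S (S k))).
    pose proof (pi_pos (S k)). rewrite (S_INR k). field. repeat split; lra.
Qed.

Let g (j i : nat) : R := if (i <=? j)%nat then - pi j * H i else pi j * G i.

(** A source [F] enters the recursion as [F k - F (k - 1)]; summing by parts against [g j] leaves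
    this increment, one step to the right of [k]. *)
Definition stein_kernel (j k : nat) : R := g j (S (S k)) - g j (S k).
Let K := stein_kernel.
Let x (k : nat) := pi (S k) * (G (S (S k)) + H (S k)).

Local Lemma K_le j k : (j <= k)%nat -> K j k = - (A k * pi j).
Proof.
  intros Hj. unfold K, stein_kernel, g, A.
  destruct (Nat.leb_spec (S (S k)) j), (Nat.leb_spec (S k) j); try lia. ring.
Qed.

Local Lemma K_eq k : K (S k) k = x k.
Proof.
  unfold K, stein_kernel, g, x.
  destruct (Nat.leb_spec (S (S k)) (S k)), (Nat.leb_spec (S k) (S k)); try lia. ring.
Qed.

Local Lemma K_gt j k : (S (S k) <= j)%nat -> K j k = - (B k * pi j).
Proof.
  intros Hj. unfold K, stein_kernel, g, B.
  destruct (Nat.leb_spec (S (S k)) j), (Nat.leb_spec (S k) j); try lia. ring.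
Qed.

Local Lemma stein_g j i :
  w i * g j (S i) - INR i * g j i = (if (i =? j)%nat then 1 else 0) - pi j.
Proof.
  pose proof (pi_pos i). pose proof (pi_pos j). pose proof (w_pos i).
  assert (HS : w i * H (S i) = L (S i) / pi i).
  { unfold H. rewrite (pi_ratio i), S_INR. fold (w i). pose proof (pos_INR i).
    field. repeat split; lra. }
  assert (GS : w i * G (S i) = Rt (S i) / pi i).
  { unfold G. rewrite (pi_ratio i), S_INR. fold (w i). pose proof (pos_INR i).
    field. repeat split; lra. }
  assert (HI : INR i * H i = L i / pi i).
  { unfold H. destruct i as [|i]; [unfold L, Rdiv; simpl; ring|].
    rewrite S_INR. pose proof (pos_INR i). field. split; lra. }
  unfold g.
  destruct (Nat.leb_spec (S i) j), (Nat.leb_spec i j), (Nat.eqb_spec i j); try lia.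
  - replace (w i * (- pi j * H (S i)) - INR i * (- pi j * H i))
      with (- pi j * (w i * H (S i) - INR i * H i)) by ring.
    rewrite HS, HI, L_S. field. lra.
  - subst i.
    replace (w j * (pi j * G (S j)) - INR j * (- pi j * H j))
      with (pi j * (w j * G (S j) + INR j * H j)) by ring.
    rewrite GS, HI. unfold Rt. rewrite L_S. field. lra.
  - replace (w i * (pi j * G (S i)) - INR i * (pi j * G i))
      with (pi j * (w i * G (S i) - INR i * G i)) by ring.
    rewrite GS. unfold G, Rt. rewrite L_S.
    assert (0 < INR i) by (apply lt_0_INR; lia). field. split; lra.
Qed.

(** The terms in [H (S k)] cancel, and [G] and [H] at [S (S k)] add up to a single quotient because
    [L + Rt = 1]. As [B k] is nonnegative, this bounds the positive entry [x k]. *)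
Local Lemma x_plus_B k : x k + pi (S k) * B k = / w (S k).
Proof.
  unfold x, B, G, H, Rt. rewrite (pi_ratio (S k)). fold (w (S k)).
  rewrite (S_INR (S k)). pose proof (pos_INR k). pose proof (w_pos (S k)).
  pose proof (pi_pos (S k)). rewrite S_INR. field. repeat split; lra.
Qed.

(** That is, column [k] of the kernel has sum zero, so its norm is twice its only positive entry. *)
Local Lemma x_balance k : x k = A k * L (S k) + B k * Rt (S (S k)).
Proof.
  unfold x, A, B, G, H, Rt. rewrite !(L_S (S k)). rewrite (pi_ratio (S k)). fold (w (S k)).
  rewrite (S_INR (S k)). pose proof (pos_INR k). pose proof (w_pos (S k)).
  pose proof (pi_pos (S k)). rewrite S_INR. field. repeat split; lra.
Qed.

Lemma stein_kernel_sum k J :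
  sumR J (fun j => Rabs (stein_kernel j k)) <= 2 / (lam + q).
Proof.
  fold K.
  assert (E1 : forall n, (n <= S k)%nat -> sumR n (fun j => Rabs (K j k)) = A k * L n).
  { intros n Hn. unfold L. rewrite <- sumR_scal. apply sumR_ext. intros i Hi.
    rewrite K_le by lia. rewrite Rabs_Ropp, Rabs_pos_eq; auto.
    apply Rmult_le_pos; [apply A_ge0 | left; auto]. }
  assert (Hx : 0 <= x k).
  { rewrite x_balance. apply Rplus_le_le_0_compat; apply Rmult_le_pos;
    auto using A_ge0, B_ge0, L_ge0, Rt_ge0. }
  assert (E2 : forall i, sumR (i + S (S k)) (fun j => Rabs (K j k))
            = A k * L (S k) + x k + B k * (L (i + S (S k)) - L (S (S k)))).
  { induction i as [|i IH].
    - cbn [Nat.add]. change (sumR (S (S k)) ?F) with (sumR (S k) F + F (S k)).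
      cbv beta. rewrite E1 by lia. rewrite K_eq, Rabs_pos_eq by exact Hx. ring.
    - cbn [Nat.add]. change (sumR (S ?n) ?F) with (sumR n F + F n) at 1. cbv beta.
      rewrite IH, K_gt, Rabs_Ropp, (L_S (i + S (S k))) by lia.
      rewrite Rabs_pos_eq by (apply Rmult_le_pos; [apply B_ge0 | left; auto]). ring. }
  (* The range is enlarged so that the entries before, at and after [S k] are all present. *)
  apply Rle_trans with (sumR (J + S (S k)) (fun j => Rabs (K j k))).
  { apply sumR_incr; [intros; apply Rabs_pos | lia]. }
  rewrite E2.
  apply Rle_trans with (2 * x k).
  - pose proof (x_balance k) as E.
    pose proof (Rmult_le_pos _ _ (B_ge0 k) (Rt_ge0 (J + S (S k)))).
    unfold Rt in *. lra.
  - pose proof (x_plus_B k). pose proof (B_ge0 k). pose proof (pi_pos (S k)).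
    assert (x k <= / w (S k)) by nra.
    assert (/ w (S k) <= / (lam + q)).
    { apply Rinv_le_contravar; [lra|]. unfold w. rewrite S_INR.
      pose proof (pos_INR k). nra. }
    unfold Rdiv. lra.
Qed.

(** This moves a difference from input to output: the kernel applied to [(1 - X) F] involves
    differences of consecutive columns, and these are [1 - X] acting in [j] on the cumulative sums
    taken here. *)
Definition stein_kernel2 (k j : nat) : R :=
  sumR (S j) (fun i => stein_kernel i k - stein_kernel i (S k)).
Let c := stein_kernel2.

Local Lemma c_le k j : (j <= k)%nat -> c k j = - ((A k - A (S k)) * L (S j)).
Proof.
  intros Hj. unfold c, stein_kernel2. fold K.
  rewrite (sumR_ext _ _ (fun i => (A (S k) - A k) * pi i)).
  - rewrite sumR_scal. unfold L. ring.
  - intros i Hi. rewrite !K_le by lia. ring.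
Qed.

Local Lemma c_S k j : c k (S j) = c k j + (K (S j) k - K (S j) (S k)).
Proof. reflexivity. Qed.

Local Lemma c_mid k : c k (S k) = B k * Rt (S (S k)) + A (S k) * L (S (S k)).
Proof.
  rewrite c_S, c_le, K_eq, K_le, x_balance by lia. rewrite (L_S (S k)). ring.
Qed.

Local Lemma c_gt k i : c k (i + S (S k)) = - ((B (S k) - B k) * Rt (S (i + S (S k)))).
Proof.
  induction i as [|i IH].
  - cbn [Nat.add]. rewrite c_S, c_mid, K_gt, K_eq, x_balance by lia.
    unfold Rt. rewrite (L_S (S (S k))). ring.
  - cbn [Nat.add]. rewrite c_S, IH, !K_gt by lia.
    unfold Rt. rewrite (L_S (S (i + S (S k)))). ring.
Qed.

Local Lemma c_mid_le k : c k (S k) <= / (lam + 2 * q).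
Proof.
  assert (E : c k (S k) + (B (S k) - B k) * Rt (S (S k)) = / w (S (S k))).
  { rewrite <- x_plus_B, c_mid, x_balance.
    unfold Rt. rewrite (L_S (S (S k))). ring. }
  assert (/ w (S (S k)) <= / (lam + 2 * q)).
  { apply Rinv_le_contravar; [lra|]. unfold w. rewrite !S_INR.
    pose proof (pos_INR k). nra. }
  pose proof (Rmult_le_pos _ _ (B_incr k) (Rt_ge0 (S (S k)))). lra.
Qed.

Local Lemma sum_L n : (1 - q) * sumR n (fun j => L (S j)) = T n.
Proof.
  induction n as [|n IH].
  - unfold T, w, L. simpl. ring.
  - rewrite T_S, <- IH. simpl. ring.
Qed.

Local Lemma tau_T n : tau n = T n - (1 - q) * INR n + lam.
Proof. unfold tau, T, Rt, w. ring. Qed.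

Local Lemma sum_R n m :
  (1 - q) * sumR n (fun j => Rt (S (j + m))) = tau m - tau (n + m).
Proof.
  induction n as [|n IH]; [simpl; ring|].
  change (sumR (S n) ?F) with (sumR n F + F n). cbv beta.
  rewrite Rmult_plus_distr_l, IH. cbn [Nat.add]. rewrite !tau_T, T_S, (S_INR (n + m)).
  unfold Rt. ring.
Qed.

(** The right side is [1 - q] times the mass of the negative entries, by [sum_L] on the left and
    [sum_R] on the right; the value of [tau] at the far end of [sum_R] is nonnegative and is dropped
    later. *)
Local Lemma c_balance k :
  (1 - q) * c k (S k) = (A k - A (S k)) * T (S k) + (B (S k) - B k) * tau (S (S k)).
Proof.
  assert (Et : tau (S k) = tau (S (S k)) + (1 - q) * Rt (S (S k))).
  { rewrite !tau_T, (T_S (S k)), (S_INR (S k)). unfold Rt. ring. }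
  rewrite c_mid, !A_eq, !B_eq, Et, (T_S (S k)), (pi_ratio (S k)).
  fold (w (S k)). rewrite (S_INR (S k)).
  pose proof (pos_INR k). pose proof (w_pos (S k)). pose proof (w_pos (S (S k))).
  pose proof (pi_pos (S k)). rewrite (S_INR k). field. repeat split; lra.
Qed.

Lemma stein_kernel2_sum k J :
  sumR J (fun j => Rabs (stein_kernel2 k j)) <= 2 / (lam + 2 * q).
Proof.
  fold c.
  assert (E1 : sumR (S k) (fun j => (1 - q) * Rabs (c k j)) = (A k - A (S k)) * T (S k)).
  { rewrite <- sum_L, <- !sumR_scal. apply sumR_ext. intros i Hi.
    rewrite c_le, Rabs_Ropp by lia.
    rewrite Rabs_pos_eq by (apply Rmult_le_pos; [apply A_decr | apply L_ge0]). ring. }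
  assert (Hc : 0 <= c k (S k)).
  { rewrite c_mid. apply Rplus_le_le_0_compat; apply Rmult_le_pos;
    auto using A_ge0, B_ge0, L_ge0, Rt_ge0. }
  assert (E2 : forall i, sumR (i + S (S k)) (fun j => (1 - q) * Rabs (c k j))
     = (A k - A (S k)) * T (S k) + (1 - q) * c k (S k)
       + (B (S k) - B k) * (tau (S (S k)) - tau (i + S (S k)))).
  { intros i. rewrite <- sum_R. induction i as [|i IH].
    - cbn [Nat.add]. change (sumR (S (S k)) ?F) with (sumR (S k) F + F (S k)).
      cbv beta. rewrite E1, Rabs_pos_eq by auto. simpl. ring.
    - cbn [Nat.add]. change (sumR (S ?n) ?F) with (sumR n F + F n). cbv beta.
      rewrite IH, c_gt, Rabs_Ropp, Rabs_pos_eq by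
        (apply Rmult_le_pos; [apply B_incr | apply Rt_ge0]). ring. }
  apply Rle_trans with (2 * c k (S k)).
  - apply Rmult_le_reg_l with (1 - q); [lra|].
    apply Rle_trans with (sumR (J + S (S k)) (fun j => (1 - q) * Rabs (c k j))).
    { rewrite <- sumR_scal. apply sumR_incr; [|lia].
      intros; apply Rmult_le_pos; [lra | apply Rabs_pos]. }
    rewrite E2. pose proof (c_balance k).
    pose proof (Rmult_le_pos _ _ (B_incr k) (tau_ge0 (J + S (S k)))). lra.
  - pose proof (c_mid_le k). unfold Rdiv. lra.
Qed.

Local Lemma G_decr k : G (S (S k)) <= G (S k).
Proof. pose proof (A_ge0 k). unfold A in *. lra. Qed.

Local Lemma G_ge0 k : 0 <= G (S k).
Proof.
  apply Rdiv_le_0_compat; [apply Rt_ge0|].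
  apply Rmult_lt_0_compat; auto. apply lt_0_INR; lia.
Qed.

Local Lemma G_le k : G (S k) <= G 1.
Proof. induction k as [|k IH]; [lra|]. pose proof (G_decr k). lra. Qed.

(** The Stein equation for [j = 0] reads [m * G m = 1 + w m * G (m + 1)]; since [G] decreases, the
    right side is at most [1 + (lam + q * m) * G m], and [q < 1] lets the term in [m] be
    absorbed. *)
Local Lemma mG_bounded k : INR (S k) * G (S k) <= (1 + lam * G 1) / (1 - q).
Proof.
  pose proof (stein_g 0 (S k)) as E. unfold g in E.
  simpl Nat.leb in E. simpl Nat.eqb in E.
  pose proof (pi_pos 0).
  assert (E' : INR (S k) * G (S k) = 1 + w (S k) * G (S (S k))).
  { apply Rmult_eq_reg_l with (pi 0); lra. }
  pose proof (G_decr k). pose proof (w_pos (S k)). pose proof (G_le k).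
  pose proof (G_ge0 k).
  assert (w (S k) * G (S (S k)) <= w (S k) * G (S k)) by nra.
  apply Rmult_le_reg_l with (1 - q); [lra|].
  replace ((1 - q) * ((1 + lam * G 1) / (1 - q))) with (1 + lam * G 1) by (field; lra).
  unfold w in *. nra.
Qed.

(* Pair [d] with the solution [g j] and sum by parts; the boundary term vanishes because
   [m * G m] is bounded. *)
Lemma stein_representation d F j :
  l1 d -> is_series d 0 -> l1 F ->
  (forall i, (INR i + 1) * d (S i) - (lam + q * INR i) * d i = F i - shift1 F i) ->
  is_series (fun k => F k * stein_kernel j k) (d j).
Proof.
  intros Hd Hd0 HF Hrec.
  assert (Esum : forall N, sumR N (fun i => F i * stein_kernel j i)
     = sumR N (fun i => d i * ((if (i =? j)%nat then 1 else 0) - pi j))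
       - INR N * g j N * d N + shift1 F N * g j (S N)).
  { induction N as [|N IH]; [simpl; ring|].
    change (sumR (S N) ?F) with (sumR N F + F N). cbv beta.
    rewrite IH, <- stein_g. unfold stein_kernel. simpl shift1.
    pose proof (Hrec N) as E. rewrite S_INR.
    replace (F N * (g j (S (S N)) - g j (S N)))
      with (F N * g j (S (S N)) - F N * g j (S N)) by ring.
    replace (F N) with ((INR N + 1) * d (S N) - (lam + q * INR N) * d N + shift1 F N) at 2 by lra.
    unfold w. ring. }
  (* Only large [N] matters for the limit, and beyond [j] the solution [g j] follows its bounded
     branch [G]. *)
  assert (Hbound : exists M, forall N, (j < N)%nat -> Rabs (INR N * g j N) <= M
                                         /\ Rabs (g j (S N)) <= M).
  { exists (pi j * ((1 + lam * G 1) / (1 - q)) + pi j * G 1). intros N HN.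
    pose proof (pi_pos j). pose proof (G_ge0 0). 
    assert (0 <= (1 + lam * G 1) / (1 - q)) by (apply Rdiv_le_0_compat; nra).
    unfold g. destruct (Nat.leb_spec N j), (Nat.leb_spec (S N) j); try lia.
    destruct N as [|N]; [lia|].
    pose proof (mG_bounded N). pose proof (G_ge0 N). pose proof (G_le (S N)).
    pose proof (G_ge0 (S N)). pose proof (pos_INR (S N)).
    set (C := (1 + lam * G 1) / (1 - q)) in *.
    assert (0 <= INR (S N) * G (S N)) by now apply Rmult_le_pos.
    split.
    - replace (INR (S N) * (pi j * G (S N))) with (pi j * (INR (S N) * G (S N))) by ring.
      rewrite Rabs_pos_eq by nra. nra.
    - rewrite Rabs_pos_eq by nra. nra. }
  destruct Hbound as [M HM].
  assert (Hlim0 : forall u v : nat -> R, is_lim_seq u 0 ->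
            (forall N, (j < N)%nat -> Rabs (v N) <= M) -> is_lim_seq (fun N => v N * u N) 0).
  { intros u v Hu Hv. apply is_lim_seq_abs_0.
    apply is_lim_seq_le_le_loc with (fun _ => 0) (fun N => M * Rabs (u N)).
    - exists (S j). intros N HN. split; [apply Rabs_pos|].
      rewrite Rabs_mult. apply Rmult_le_compat_r; [apply Rabs_pos | apply Hv; lia].
    - apply is_lim_seq_const.
    - replace (Finite 0) with (Rbar_mult M 0) by (simpl; f_equal; ring).
      apply is_lim_seq_scal_l. apply is_lim_seq_abs_0 in Hu. exact Hu. }
  apply is_series_sumR_lim.
  apply is_lim_seq_ext with (1 := fun N => eq_sym (Esum N)).
  replace (Finite (d j)) with (Finite ((d j - pi j * 0) - 0 + 0)) by (f_equal; ring).
  apply is_lim_seq_plus'; [apply is_lim_seq_minus'|].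
  - apply is_lim_seq_ext with
      (fun N => sumR N (fun i => d i * (if (i =? j)%nat then 1 else 0)) - pi j * sumR N d).
    { intros N. induction N as [|N IH]; simpl; [ring | rewrite <- IH; ring]. }
    apply is_lim_seq_minus'.
    + apply is_series_sumR_lim.
      replace (d j) with (sumR (S j) (fun i => d i * (if (i =? j)%nat then 1 else 0))).
      * apply is_series_finite. intros k Hk. destruct (Nat.eqb_spec k j); [lia | ring].
      * simpl. rewrite Nat.eqb_refl.
        rewrite (sumR_ext j _ (fun _ => 0)); [rewrite sumR_zero; ring|].
        intros i Hi. destruct (Nat.eqb_spec i j); [lia | ring].
    + replace (Finite (pi j * 0)) with (Rbar_mult (pi j) 0) by (simpl; f_equal; ring).
      apply is_lim_seq_scal_l. now apply is_series_sumR_lim.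
  - apply (Hlim0 d (fun N => INR N * g j N)).
    + apply ex_series_lim_0. now apply l1_ex_series.
    + intros N HN. now apply HM.
  - apply is_lim_seq_ext with (fun N => g j (S N) * shift1 F N); [intros; ring|].
    apply (Hlim0 (shift1 F) (fun N => g j (S N))).
    + apply is_lim_seq_incr_1. simpl. apply ex_series_lim_0. now apply l1_ex_series.
    + intros N HN. now apply HM.
Qed.
End Stein_kernel.

(** * The binomial series with real exponent and the negative binomial law *)

Lemma rising_pos al m : 0 < al -> 0 < rising al m.
Proof.
  intros Ha. induction m as [|m IH]; simpl; [lra|].
  apply Rmult_lt_0_compat; auto. pose proof (pos_INR m). lra.
Qed.

Lemma gbinom_pos al m : 0 < al -> 0 < gbinom al m.
Proof.
  intros Ha. apply Rdiv_lt_0_compat; [now apply rising_pos | apply INR_fact_lt_0].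
Qed.

Lemma gbinom_S al m : (INR m + 1) * gbinom al (S m) = (al + INR m) * gbinom al m.
Proof.
  unfold gbinom. rewrite fact_simpl, mult_INR, S_INR. simpl rising.
  pose proof (pos_INR m). pose proof (INR_fact_neq_0 m). field. split; lra.
Qed.

Lemma CV_radius_gbinom al : 0 < al -> CV_radius (gbinom al) = 1.
Proof.
  intros Ha. replace (Finite 1) with (Finite (/ 1)) by (f_equal; field).
  apply CV_radius_finite_DAlembert; [|lra|].
  { intros n. apply Rgt_not_eq, gbinom_pos; auto. }
  apply is_lim_seq_ext with (fun n => 1 + (al - 1) * / INR (S n)).
  { intros n. pose proof (gbinom_pos al n Ha). pose proof (pos_INR n).
    replace (gbinom al (S n) / gbinom al n) with ((al + INR n) / (INR n + 1)).
    - rewrite Rabs_pos_eq by (apply Rdiv_le_0_compat; lra).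
      rewrite S_INR. field. lra.
    - apply Rmult_eq_reg_l with ((INR n + 1) * gbinom al n); [|nra].
      transitivity ((INR n + 1) * gbinom al (S n)); [|field; lra].
      rewrite gbinom_S. field. lra. }
  replace (Finite 1) with (Rbar_plus 1 (Rbar_mult (al - 1) 0)) by (simpl; f_equal; ring).
  apply is_lim_seq_plus'; [apply is_lim_seq_const|].
  apply (is_lim_seq_scal_l _ (al - 1) 0).
  apply (is_lim_seq_incr_1 (fun n => / INR n)).
  replace (Finite 0) with (Rbar_inv p_infty) by reflexivity.
  apply is_lim_seq_inv; [apply is_lim_seq_INR | discriminate].
Qed.

(** The recursion of the coefficients is the differential equation [(1 - t) * u' = al * u], so the
    product has derivative zero on [[0, x]] and keeps its value at 0. *)
Lemma PSeries_gbinom al x :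
  0 < al -> 0 < x < 1 -> PSeries (gbinom al) x * Rpower (1 - x) al = 1.
Proof.
  intros Ha Hx.
  set (h := fun t => PSeries (gbinom al) t * Rpower (1 - t) al).
  assert (Hcv : forall t, 0 <= t <= x -> Rbar_lt (Rabs t) (CV_radius (gbinom al))).
  { intros t Ht. rewrite CV_radius_gbinom by auto. simpl. rewrite Rabs_pos_eq; lra. }
  assert (Hrec : forall t, 0 <= t <= x ->
            (1 - t) * PSeries (PS_derive (gbinom al)) t = al * PSeries (gbinom al) t).
  { intros t Ht.
    assert (Hd : ex_pseries (PS_derive (gbinom al)) t).
    { apply CV_radius_inside. rewrite CV_radius_derive. now apply Hcv. }
    assert (Hg : ex_pseries (gbinom al) t) by (apply CV_radius_inside; now apply Hcv).
    rewrite Rmult_minus_distr_r, Rmult_1_l, <- PSeries_incr_1, <- PSeries_scal, <- PSeries_minus.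
    - apply PSeries_ext. intros n.
      unfold PS_minus, PS_plus, PS_opp, PS_scal, PS_derive, PS_incr_1.
      unfold plus, opp, scal; simpl; unfold mult; simpl.
      destruct n as [|n].
      + pose proof (gbinom_S al 0). simpl in *. unfold zero; simpl. lra.
      + pose proof (gbinom_S al (S n)) as E. rewrite S_INR in *.
        change (match n with O => 1 | S _ => INR n + 1 end) with (INR (S n)) in *.
        rewrite ?S_INR in *. lra.
    - auto.
    - now apply ex_pseries_incr_1. }
  assert (Heq : h 0 = h x).
  { apply (eq_is_derive h 0 x); [|lra].
    intros t Ht.
    assert (D : is_derive h t
      (PSeries (PS_derive (gbinom al)) t * Rpower (1 - t) al
       + PSeries (gbinom al) t * (al * Rpower (1 - t) al / (1 - t) * (-1)))).
    { apply (is_derive_mult (PSeries (gbinom al)) (fun t => Rpower (1 - t) al)).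
      - apply is_derive_PSeries. now apply Hcv.
      - unfold Rpower. auto_derive; [lra|]. replace (1 + - t) with (1 - t) by ring. field. lra.
      - intros; apply Rmult_comm. }
    replace (PSeries (PS_derive (gbinom al)) t)
      with (al * PSeries (gbinom al) t / (1 - t)) in D
      by (rewrite <- Hrec by auto; field; lra).
    match type of D with is_derive _ _ ?e => replace e with 0 in D by (field; lra) end.
    exact D. }
  fold (h x). rewrite <- Heq. unfold h.
  rewrite PSeries_0, Rminus_0_r. unfold gbinom, Rpower. simpl.
  rewrite ln_1, Rmult_0_r, exp_0. field.
Qed.

Lemma nb_pmf_pos al p m : 0 < al -> 0 < p < 1 -> 0 < nb_pmf al p m.
Proof.
  intros Ha Hp. unfold nb_pmf, Rpower.
  pose proof (gbinom_pos al m Ha). pose proof (exp_pos (al * ln p)).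
  assert (0 < (1 - p) ^ m) by (apply pow_lt; lra).
  apply Rmult_lt_0_compat; auto. now apply Rmult_lt_0_compat.
Qed.

Lemma is_series_nb al p : 0 < al -> 0 < p < 1 -> is_series (nb_pmf al p) 1.
Proof.
  intros Ha Hp.
  assert (Hs : is_series (fun m => gbinom al m * (1 - p) ^ m) (PSeries (gbinom al) (1 - p))).
  { apply is_series_ext with (fun k => scal (pow_n (1 - p) k) (gbinom al k)).
    - intros n. rewrite pow_n_pow. unfold scal; simpl; unfold mult; simpl. ring.
    - apply PSeries_correct, CV_radius_inside. rewrite CV_radius_gbinom by auto.
      simpl. rewrite Rabs_pos_eq; lra. }
  rewrite <- (PSeries_gbinom al (1 - p)) by (auto; lra).
  replace (1 - (1 - p)) with p by ring. rewrite Rmult_comm.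
  apply is_series_ext with (fun m => scal (Rpower p al) (gbinom al m * (1 - p) ^ m)).
  - intros n. unfold nb_pmf, scal; simpl; unfold mult; simpl. ring.
  - now apply @is_series_scal.
Qed.

Lemma nb_pmf_S al p m :
  (INR m + 1) * nb_pmf al p (S m) = (al * (1 - p) + (1 - p) * INR m) * nb_pmf al p m.
Proof.
  unfold nb_pmf. simpl pow.
  transitivity ((INR m + 1) * gbinom al (S m) * (Rpower p al * (1 - p) * (1 - p) ^ m)); [ring|].
  rewrite gbinom_S. ring.
Qed.

(** * Norm bounds for solutions of the Stein equation *)

(** The outer sum is cut at [J] before the order of summation changes, so only a finite sum is
    exchanged with a series. *)
Lemma schur_test (K : nat -> nat -> R) M F :
  (forall k J, sumR J (fun j => Rabs (K j k)) <= M) -> l1 F ->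
  let E := fun j => Series (fun k => F k * K j k) in
  l1 E /\ norm1 E <= M * norm1 F /\ (forall j, is_series (fun k => F k * K j k) (E j)).
Proof.
  intros HK HF E.
  assert (HK1 : forall j k, Rabs (K j k) <= M).
  { intros j k. eapply Rle_trans; [|apply (HK k (S j))]. simpl.
    pose proof (sumR_ge0 j (fun j => Rabs (K j k)) (fun i _ => Rabs_pos _)). lra. }
  assert (Habs : forall j, ex_series (fun k => Rabs (F k * K j k))).
  { intros j. apply @ex_series_le with (fun k => M * Rabs (F k)).
    - intros n. unfold norm; simpl. unfold abs; simpl.
      rewrite Rabs_Rabsolu, Rabs_mult, Rmult_comm.
      apply Rmult_le_compat_r; [apply Rabs_pos | apply HK1].
    - now apply @ex_series_scal. }
  assert (HE : forall j, is_series (fun k => F k * K j k) (E j)).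
  { intros j. apply Series_correct. now apply ex_series_Rabs. }
  assert (HB : l1 E /\ norm1 E <= M * norm1 F).
  { apply l1_bounded. intros J.
    apply Rle_trans with (sumR J (fun j => Series (fun k => Rabs (F k * K j k)))).
    - apply sumR_le. intros j _. now apply Series_Rabs.
    - rewrite <- (is_series_unique _ _ (Series_sumR J (fun j k => Rabs (F k * K j k)) (fun i _ => Habs i))).
      unfold norm1. rewrite <- Series_scal_l. apply Series_le.
      + intros k. split; [apply sumR_ge0; intros; apply Rabs_pos|].
        rewrite (sumR_ext J _ (fun i => Rabs (F k) * Rabs (K i k)))
          by (intros; apply Rabs_mult).
        rewrite sumR_scal, Rmult_comm.
        apply Rmult_le_compat_r; [apply Rabs_pos | apply HK].
      + now apply @ex_series_scal. }
  tauto.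
Qed.

Lemma lin_mult a b g k : ((pC a - pC b * pX) * g)%fps k = a * g k - b * shift1 g k.
Proof.
  replace ((pC a - pC b * pX) * g)%fps with (pC a * g - pC b * (pX * g))%fps by ring.
  rewrite !conv_C, conv_X. reflexivity.
Qed.

Lemma one_minus_X_mult g k : ((1 - pX) * g)%fps k = g k - shift1 g k.
Proof.
  replace (1 - pX)%fps with (pC 1 - pC 1 * pX)%fps by (rewrite pC_1; ring).
  rewrite lin_mult. ring.
Qed.

Lemma stein_equation_coeff q al d F :
  ((1 - pC q * pX) * pderiv d = pC (al * q) * d + (1 - pX) * F)%fps ->
  forall i, (INR i + 1) * d (S i) - (al * q + q * INR i) * d i = F i - shift1 F i.
Proof.
  intros E i. apply (f_equal (fun g => g i)) in E.
  unfold padd in E. rewrite one_minus_X_mult, <- pC_1, lin_mult, conv_C in E.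
  replace (shift1 (pderiv d) i) with (INR i * d i) in E.
  - unfold pderiv in E. lra.
  - destruct i as [|i]; [simpl; ring|]. unfold shift1, pderiv. rewrite S_INR. ring.
Qed.

Lemma stein_bound q al d F :
  0 < q < 1 -> 0 < al -> l1 d -> is_series d 0 -> l1 F ->
  ((1 - pC q * pX) * pderiv d = pC (al * q) * d + (1 - pX) * F)%fps ->
  norm1 d <= 2 / ((al + 1) * q) * norm1 F.
Proof.
  intros Hq Ha Hd Hd0 HF E.
  assert (Hlam : 0 < al * q) by nra.
  set (pi := nb_pmf al (1 - q)).
  assert (Hpi : forall j, 0 < pi j) by (intros; apply nb_pmf_pos; lra).
  assert (Hrec : forall j, (INR j + 1) * pi (S j) = (al * q + q * INR j) * pi j).
  { intros j. unfold pi. rewrite nb_pmf_S. replace (1 - (1 - q)) with q by ring. ring. }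
  assert (Hs : is_series pi 1) by (apply is_series_nb; lra).
  destruct (schur_test (stein_kernel pi) (2 / (al * q + q)) F) as [_ [H2 H3]]; auto.
  { intros k J. now apply stein_kernel_sum. }
  replace ((al + 1) * q) with (al * q + q) by ring.
  replace d with (fun j => Series (fun k => F k * stein_kernel pi j k)); auto.
  apply functional_extensionality. intros j. apply is_series_unique.
  apply (stein_representation q (al * q) pi); auto; try lra.
  now apply stein_equation_coeff.
Qed.

(** Here [m] may be arbitrarily large. The part of the solution caused by [pC m * (1 - X) * F] is
    therefore kept as [pC m * (1 - X) * C], and neither of the two norm estimates involves [m]. *)
Lemma stein_bound_split q al m d F :
  0 < q < 1 -> 0 < al -> l1 d -> is_series d 0 -> l1 F ->
  ((1 - pC q * pX) * pderiv d
     = pC (al * q) * d + (1 - pX) * ((1 + pC m * (1 - pX)) * F))%fps ->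
  exists E C, (d = E + pC m * (1 - pX) * C)%fps /\ l1 E /\ l1 C /\
    norm1 E <= 2 / ((al + 1) * q) * norm1 F /\
    norm1 C <= 2 / ((al + 2) * q) * norm1 F.
Proof.
  intros Hq Ha Hd Hd0 HF E.
  assert (Hlam : 0 < al * q) by nra.
  set (pi := nb_pmf al (1 - q)).
  assert (Hpi : forall j, 0 < pi j) by (intros; apply nb_pmf_pos; lra).
  assert (Hrec : forall j, (INR j + 1) * pi (S j) = (al * q + q * INR j) * pi j).
  { intros j. unfold pi. rewrite nb_pmf_S. replace (1 - (1 - q)) with q by ring. ring. }
  assert (Hs : is_series pi 1) by (apply is_series_nb; lra).
  destruct (schur_test (stein_kernel pi) (2 / (al * q + q)) F) as [HE1 [HE2 HE3]]; auto.
  { intros k J. now apply stein_kernel_sum. }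
  destruct (schur_test (fun j k => stein_kernel2 pi k j) (2 / (al * q + 2 * q)) F)
    as [HC1 [HC2 HC3]]; auto.
  { intros k J. now apply stein_kernel2_sum. }
  set (Ev := fun j => Series (fun k => F k * stein_kernel pi j k)) in *.
  set (Cv := fun j => Series (fun k => F k * stein_kernel2 pi k j)) in *.
  exists Ev, Cv. repeat split; auto.
  2:{ replace ((al + 1) * q) with (al * q + q) by ring. auto. }
  2:{ replace ((al + 2) * q) with (al * q + 2 * q) by ring. auto. }
  apply functional_extensionality. intros j.
  assert (HF' : l1 ((1 + pC m * (1 - pX)) * F)%fps).
  { apply l1_mult; auto. apply l1_plus; [apply l1_one|]. apply l1_C_mult.
    apply l1_minus; [apply l1_one | apply l1_X]. }
  assert (R := stein_representation q (al * q) pi ltac:(lra) ltac:(lra) Hlam Hpi Hrec Hs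
     d _ j Hd Hd0 HF' (stein_equation_coeff _ _ _ _ E)).
  (* Column [S k] is column [k] minus the difference in [j] of [stein_kernel2]; pairing [F] with it
     is pairing the shifted [F] with the kernel. *)
  assert (Rs : is_series (fun k => F k * stein_kernel pi j (S k) )
     (Ev j - (Cv j - shift1 Cv j))).
  { apply is_series_ext with (fun k => minus (F k * stein_kernel pi j k)
      (minus (F k * stein_kernel2 pi k j)
         (F k * shift1 (stein_kernel2 pi k) j))).
    - intros k. unfold minus, plus, opp; simpl.
      assert (Ek : stein_kernel2 pi k j - shift1 (stein_kernel2 pi k) j
               = stein_kernel pi j k - stein_kernel pi j (S k)).
      { destruct j as [|j]; unfold stein_kernel2; simpl; ring. }
      replace (stein_kernel pi j (S k))
        with (stein_kernel pi j k - (stein_kernel2 pi k j - shift1 (stein_kernel2 pi k) j)) by lra.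
      ring.
    - apply @is_series_minus; [apply HE3|]. apply @is_series_minus; [apply HC3|].
      destruct j as [|j]; simpl; [|apply HC3].
      apply (is_series_finite (fun k => F k * 0) O). intros; ring. }
  assert (Rsh : is_series (fun k => shift1 F k * stein_kernel pi j k) (Ev j - (Cv j - shift1 Cv j))).
  { apply is_series_sumR_lim. apply is_lim_seq_incr_1.
    apply is_series_sumR_lim in Rs. apply is_lim_seq_ext with (2 := Rs).
    intros n. rewrite sumR_head. simpl. ring. }
  assert (R' : is_series (fun k => ((1 + pC m * (1 - pX)) * F)%fps k * stein_kernel pi j k)
      (Ev j + m * (Ev j - (Ev j - (Cv j - shift1 Cv j))))).
  { apply is_series_ext with (fun k => plus (F k * stein_kernel pi j k)
      (scal m (minus (F k * stein_kernel pi j k) (shift1 F k * stein_kernel pi j k)))).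
    - intros k.
      replace ((1 + pC m * (1 - pX)) * F)%fps with (F + pC m * ((1 - pX) * F))%fps by ring.
      unfold padd. rewrite conv_C, one_minus_X_mult.
      unfold minus, plus, opp, scal; simpl; unfold mult; simpl. ring.
    - apply @is_series_plus; auto. apply @is_series_scal.
      apply @is_series_minus; auto. }
  apply is_series_unique in R. apply is_series_unique in R'.
  rewrite R in R'. rewrite R'.
  replace (pC m * (1 - pX) * Cv)%fps with (pC m * ((1 - pX) * Cv))%fps by ring.
  unfold padd. rewrite conv_C, one_minus_X_mult. ring.
Qed.

(** * Smoothness of sums of independent variables *)

(** The law of a fair coin; [kap_pow m] is then the binomial law with [m] trials and success
    probability 1/2. *)
Definition kap : nat -> R := (pC (1 / 2) * (1 + pX))%fps.

Fixpoint kap_pow (m : nat) : nat -> R :=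
  match m with O => delta0 | S m => (kap * kap_pow m)%fps end.

Lemma kap_mult g k : (kap * g)%fps k = 1 / 2 * (g k + shift1 g k).
Proof.
  unfold kap. replace (pC (1 / 2) * (1 + pX) * g)%fps with (pC (1 / 2) * (g + pX * g))%fps by ring.
  rewrite conv_C, conv_X. reflexivity.
Qed.

Lemma kap_pow_add a b : kap_pow (a + b) = (kap_pow a * kap_pow b)%fps.
Proof.
  induction a as [|a IH]; simpl; [ring|]. rewrite IH. ring.
Qed.

Lemma kap_pow_ge0 m k : 0 <= kap_pow m k.
Proof.
  revert k. induction m as [|m IH]; intros k.
  - destruct k; simpl; lra.
  - simpl. rewrite kap_mult. pose proof (IH k).
    destruct k as [|k]; simpl; [|pose proof (IH k)]; lra.
Qed.

Lemma kap_pow_S m k :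
  (INR k + 1) * kap_pow m (S k) = (INR m - INR k) * kap_pow m k.
Proof.
  revert k. induction m as [|m IH]; intros k.
  - destruct k as [|k]; simpl; ring.
  - cbn [kap_pow]. rewrite !kap_mult, S_INR. cbn [shift1].
    pose proof (IH k) as E1. destruct k as [|k].
    + simpl in *. lra.
    + pose proof (IH k) as E2. rewrite S_INR in *. cbn [shift1]. nra.
Qed.

Lemma kap_pow_step m k :
  (INR k + 1) * (kap_pow m (S k) - kap_pow m k) = (INR m - 2 * INR k - 1) * kap_pow m k.
Proof. pose proof (kap_pow_S m k). lra. Qed.

(** The sequence climbs from 0 to [b K] and then descends without crossing 0, so each phase has
    variation at most [b K]. *)
Lemma unimodal_variation b K :
  (forall k, 0 <= b k) ->
  (forall k, (k < K)%nat -> b k <= b (S k)) ->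
  (forall k, (K <= k)%nat -> b (S k) <= b k) ->
  l1 ((1 - pX) * b)%fps /\ norm1 ((1 - pX) * b)%fps <= 2 * b K.
Proof.
  intros H0 Hinc Hdec.
  assert (Hle : forall k, b k <= b K).
  { assert (H1 : forall i, (i <= K)%nat -> b (K - i)%nat <= b K).
    { induction i as [|i IH]; intros Hi; [rewrite Nat.sub_0_r; lra|].
      specialize (Hinc (K - S i)%nat ltac:(lia)).
      replace (S (K - S i)) with (K - i)%nat in Hinc by lia.
      specialize (IH ltac:(lia)). lra. }
    assert (H2 : forall i, b (K + i)%nat <= b K).
    { induction i as [|i IH]; [rewrite Nat.add_0_r; lra|].
      specialize (Hdec (K + i)%nat ltac:(lia)).
      rewrite Nat.add_succ_r. lra. }
    intros k. destruct (Nat.le_gt_cases k K).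
    - replace k with (K - (K - k))%nat by lia. apply H1; lia.
    - replace k with (K + (k - K))%nat by lia. apply H2. }
  assert (HS : forall n, sumR (S n) (fun k => Rabs (((1 - pX) * b)%fps k))
     = if (n <=? K)%nat then b n else 2 * b K - b n).
  { induction n as [|n IH].
    - simpl. rewrite one_minus_X_mult. simpl. rewrite Rminus_0_r, Rabs_pos_eq by auto. ring.
    - change (sumR (S (S n)) ?F) with (sumR (S n) F + F (S n)). cbv beta.
      rewrite IH, one_minus_X_mult. cbn [shift1].
      destruct (Nat.leb_spec n K), (Nat.leb_spec (S n) K); try lia.
      + rewrite Rabs_pos_eq; [ring|]. specialize (Hinc n ltac:(lia)). lra.
      + assert (n = K) by lia. subst n. specialize (Hdec K (le_n _)).
        rewrite Rabs_left1 by lra. ring.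
      + specialize (Hdec n ltac:(lia)). rewrite Rabs_left1 by lra. ring. }
  apply l1_bounded. intros [|n].
  - simpl. pose proof (H0 K). lra.
  - rewrite HS. pose proof (H0 n). pose proof (H0 K). pose proof (Hle n).
    destruct (Nat.leb_spec n K); lra.
Qed.

Lemma kap_pow_center j :
  kap_pow (2 * j + 1) j = kap_pow (2 * j) j * (2 * INR j + 1) / (2 * INR j + 2) /\
  kap_pow (2 * (j + 1)) (j + 1) = kap_pow (2 * j + 1) j.
Proof.
  pose proof (pos_INR j).
  assert (E2 : kap_pow (2 * j + 1) (S j) = kap_pow (2 * j + 1) j).
  { pose proof (kap_pow_S (2 * j + 1) j) as E.
    rewrite plus_INR, mult_INR in E. simpl (INR 2) in E. simpl (INR 1) in E.
    apply Rmult_eq_reg_l with (INR j + 1); lra. }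
  assert (E1 : kap_pow (2 * j + 1) (S j)
     = kap_pow (2 * j) j * (2 * INR j + 1) / (2 * INR j + 2)).
  { pose proof (kap_pow_S (2 * j) j) as E.
    rewrite mult_INR in E. simpl (INR 2) in E.
    rewrite Nat.add_1_r. cbn [kap_pow]. rewrite kap_mult. cbn [shift1].
    replace (kap_pow (2 * j) (S j)) with (INR j * kap_pow (2 * j) j / (INR j + 1)).
    - field. lra.
    - apply Rmult_eq_reg_l with (INR j + 1); [|lra]. rewrite E. field. lra. }
  split; [rewrite <- E2; exact E1|].
  replace (2 * (j + 1))%nat with (S (2 * j + 1)) by lia.
  replace (j + 1)%nat with (S j) by lia. cbn [kap_pow]. rewrite kap_mult. cbn [shift1].
  rewrite E2. field.
Qed.

(** The classical bound on the central binomial coefficient. The form [3 j + 1] closes the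
    induction: with [t = j], the two sides of [(2 t + 1)^2 (3 t + 4) <= (2 t + 2)^2 (3 t + 1)]
    differ by exactly [t]. *)
Lemma kap_pow_center_le j :
  kap_pow (2 * j) j ^ 2 * (3 * INR j + 1) <= 1.
Proof.
  induction j as [|j IH]; [simpl; lra|].
  destruct (kap_pow_center j) as [E1 E2].
  replace (S j) with (j + 1)%nat by lia. rewrite E2, E1, plus_INR. simpl (INR 1).
  pose proof (pos_INR j). set (t := INR j) in *. set (y := kap_pow (2 * j) j) in *.
  replace ((y * (2 * t + 1) / (2 * t + 2)) ^ 2 * (3 * (t + 1) + 1))
    with (y ^ 2 * (3 * t + 1) *
       (((2 * t + 1) ^ 2 * (3 * t + 4)) / ((2 * t + 2) ^ 2 * (3 * t + 1)))) by (field; lra).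
  assert (((2 * t + 1) ^ 2 * (3 * t + 4)) / ((2 * t + 2) ^ 2 * (3 * t + 1)) <= 1).
  { apply Rle_div_l; [|nra]. assert (0 < (2 * t + 2) ^ 2) by (apply pow_lt; lra).
    apply Rmult_lt_0_compat; lra. }
  assert (0 <= ((2 * t + 1) ^ 2 * (3 * t + 4)) / ((2 * t + 2) ^ 2 * (3 * t + 1))).
  { apply Rdiv_le_0_compat; [|assert (0 < (2 * t + 2) ^ 2) by (apply pow_lt; lra);
    apply Rmult_lt_0_compat; lra].
    apply Rmult_le_pos; [apply pow2_ge_0 | lra]. }
  assert (0 <= y ^ 2 * (3 * t + 1)) by (apply Rmult_le_pos; [apply pow2_ge_0 | lra]).
  nra.
Qed.

Lemma kap_pow_peak m :
  exists K, (2 * K <= m)%nat /\ (m <= 2 * K + 1)%nat /\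
    kap_pow m K ^ 2 * (3 / 2 * INR m + 1) <= 1.
Proof.
  destruct (Nat.Even_or_Odd m) as [[j ->]|[j ->]]; exists j; repeat split; try lia.
  - pose proof (kap_pow_center_le j). rewrite mult_INR. simpl (INR 2).
    replace (3 / 2 * (2 * INR j) + 1) with (3 * INR j + 1) by field. lra.
  - destruct (kap_pow_center j) as [_ E2]. pose proof (kap_pow_center_le (j + 1)) as H.
    rewrite E2, plus_INR in H. rewrite plus_INR, mult_INR. simpl (INR 2). simpl (INR 1) in *.
    pose proof (pow2_ge_0 (kap_pow (2 * j + 1) j)). nra.
Qed.

Lemma kap_pow_variation m :
  l1 ((1 - pX) * kap_pow m)%fps /\
  norm1 ((1 - pX) * kap_pow m)%fps ^ 2 * (3 / 2 * INR m + 1) <= 4.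
Proof.
  destruct (kap_pow_peak m) as [K [HK1 [HK2 HK]]].
  destruct (unimodal_variation (kap_pow m) K) as [H1 H2].
  - apply kap_pow_ge0.
  - intros k Hk. pose proof (kap_pow_step m k). pose proof (kap_pow_ge0 m k).
    pose proof (pos_INR k).
    assert (2 * INR k + 2 <= INR m).
    { replace (2 * INR k + 2) with (INR (2 * k + 2)) by
        (rewrite plus_INR, mult_INR; simpl; ring). apply le_INR; lia. }
    assert (0 <= (INR k + 1) * (kap_pow m (S k) - kap_pow m k)) by (rewrite H; nra).
    nra.
  - intros k Hk. pose proof (kap_pow_step m k). pose proof (kap_pow_ge0 m k).
    pose proof (pos_INR k).
    assert (INR m <= 2 * INR k + 1).
    { replace (2 * INR k + 1) with (INR (2 * k + 1)) by
        (rewrite plus_INR, mult_INR; simpl; ring). apply le_INR; lia. }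
    assert ((INR k + 1) * (kap_pow m (S k) - kap_pow m k) <= 0) by (rewrite H; nra).
    nra.
  - split; auto. pose proof (norm1_ge0 _ H1). pose proof (pos_INR m).
    pose proof (kap_pow_ge0 m K).
    set (v := norm1 ((1 - pX) * kap_pow m)%fps) in *.
    assert (v ^ 2 <= 4 * kap_pow m K ^ 2) by nra. nra.
Qed.

(** The coins are divided into two nearly equal groups, and each group takes one factor [1 - X]. The
    constant is [4 / (3 / 4)], since the product of the two weights is at least
    [(3 / 4 * (N + 1)) ^ 2]. Squares are compared in order to avoid square roots. *)
Lemma kap_pow_variation2 N :
  l1 ((1 - pX) * (1 - pX) * kap_pow N)%fps /\
  norm1 ((1 - pX) * (1 - pX) * kap_pow N)%fps <= 16 / 3 * / (INR N + 1).
Proof.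
  assert (HN : exists a b, N = (a + b)%nat /\
     9 / 16 * (INR N + 1) ^ 2 <= (3 / 2 * INR a + 1) * (3 / 2 * INR b + 1)).
  { destruct (Nat.Even_or_Odd N) as [[j ->]|[j ->]].
    - exists j, j. split; [lia|]. rewrite mult_INR. simpl (INR 2).
      pose proof (pos_INR j). nra.
    - exists j, (j + 1)%nat. split; [lia|]. rewrite !plus_INR, mult_INR.
      simpl (INR 2). simpl (INR 1). pose proof (pos_INR j). nra. }
  destruct HN as [a [b [-> Hab]]].
  destruct (kap_pow_variation a) as [Ha1 Ha2], (kap_pow_variation b) as [Hb1 Hb2].
  destruct (l1_mult _ _ Ha1 Hb1) as [H1 H2].
  rewrite kap_pow_add.
  replace ((1 - pX) * (1 - pX) * (kap_pow a * kap_pow b))%fps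
    with ((1 - pX) * kap_pow a * ((1 - pX) * kap_pow b))%fps by ring.
  split; auto. eapply Rle_trans; [exact H2|].
  pose proof (norm1_ge0 _ Ha1). pose proof (norm1_ge0 _ Hb1).
  pose proof (pos_INR (a + b)). pose proof (pos_INR a). pose proof (pos_INR b).
  set (u := norm1 ((1 - pX) * kap_pow a)%fps) in *.
  set (v := norm1 ((1 - pX) * kap_pow b)%fps) in *.
  set (n := INR (a + b) + 1) in *. assert (0 < n) by (unfold n; lra).
  assert (Hsq : (u * v * n) ^ 2 <= (16 / 3) ^ 2).
  { assert (E : (u ^ 2 * (3 / 2 * INR a + 1)) * (v ^ 2 * (3 / 2 * INR b + 1)) <= 4 * 4).
    { apply Rmult_le_compat; auto; apply Rmult_le_pos; try apply pow2_ge_0; lra. }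
    assert (0 <= u ^ 2 * v ^ 2) by (apply Rmult_le_pos; apply pow2_ge_0).
    assert (u ^ 2 * v ^ 2 * (9 / 16 * n ^ 2)
       <= u ^ 2 * v ^ 2 * ((3 / 2 * INR a + 1) * (3 / 2 * INR b + 1)))
      by (apply Rmult_le_compat_l; auto).
    nra. }
  assert (u * v * n <= 16 / 3).
  { (apply Rnot_lt_le; intros Hc;
      assert ((16 / 3) ^ 2 < (u * v * n) ^ 2) by nra; lra). }
  apply Rmult_le_reg_r with n; auto.
  replace (16 / 3 * / n * n) with (16 / 3) by (field; lra). lra.
Qed.

(* [ring] does not see [R] through the carriers of Coquelicot's structures. *)
Ltac eqR := match goal with |- @eq _ ?a ?b => change (@eq R a b) end.

(* [unif N t] replaces E[1 / (N + S + 1)] for a sum [S] of independent indicators of total mean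
   [t]: 1 / (n + 1) is the integral of s^n, and 1 - xi (1 - s) <= exp (- xi (1 - s)). *)
Definition unif (N : nat) (t : R) := RInt (fun s => s ^ N * exp (- (t * (1 - s)))) 0 1.

Lemma ex_RInt_cont (g : R -> R) a b : (forall s, continuous g s) -> ex_RInt g a b.
Proof. intros H. apply @ex_RInt_continuous. auto. Qed.

Lemma unif_cont N t s : continuous (fun s => s ^ N * exp (- (t * (1 - s)))) s.
Proof. apply @ex_derive_continuous. auto_derive. auto. Qed.

Lemma unif_0 N : unif N 0 = / (INR N + 1).
Proof.
  unfold unif.
  rewrite (RInt_ext _ (fun s => s ^ N)).
  2:{ intros s _. rewrite Rmult_0_l, Ropp_0, exp_0. apply Rmult_1_r. }
  assert (H : is_RInt (fun s => s ^ N) 0 1 (1 ^ S N / INR (S N) - 0 ^ S N / INR (S N))).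
  { apply (is_RInt_derive (fun s => s ^ S N / INR (S N))).
    - intros s _. auto_derive; auto. change (match N with O => 1 | S _ => INR N + 1 end) with (INR (S N)). rewrite S_INR.
      pose proof (pos_INR N). simpl Nat.pred. field. lra.
    - intros s _. apply @ex_derive_continuous. auto_derive. auto. }
  rewrite (is_RInt_unique _ _ _ _ H). rewrite pow1, pow_i by lia. rewrite S_INR.
  pose proof (pos_INR N). eqR. field. lra.
Qed.

Lemma unif_le t : 0 < t -> unif 0 t <= / t.
Proof.
  intros Ht. unfold unif.
  assert (H : is_RInt (fun s => s ^ 0 * exp (- (t * (1 - s)))) 0 1
     (exp (- (t * (1 - 1))) / t - exp (- (t * (1 - 0))) / t)).
  { apply (is_RInt_derive (fun s => exp (- (t * (1 - s))) / t)).
    - intros s _. auto_derive; auto. simpl. replace (1 + - s) with (1 - s) by ring. field. lra.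
    - intros s _. apply unif_cont. }
  rewrite (is_RInt_unique _ _ _ _ H).
  replace (- (t * (1 - 1))) with 0 by ring. rewrite exp_0.
  pose proof (exp_pos (- (t * (1 - 0)))) as He.
  apply Rmult_le_reg_r with t; auto. field_simplify; lra.
Qed.

(** Here [tau] is the mass of the part of a summand that yields one more coin. The inequality holds
    under the integral sign for every [s]. *)
Lemma unif_mix N t tau xi :
  xi <= tau ->
  tau * unif (S N) t + (1 - tau) * unif N t <= unif N (t + xi).
Proof.
  intros Hx. unfold unif.
  assert (HI := fun M => RInt_correct _ _ _ (ex_RInt_cont _ 0 1 (unif_cont M t))).
  pose proof (is_RInt_unique _ _ _ _
    (is_RInt_plus _ _ _ _ _ _ (is_RInt_scal _ _ _ tau _ (HI (S N)))
       (is_RInt_scal _ _ _ (1 - tau) _ (HI N)))) as E.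
  eapply Rle_trans; [right; symmetry; exact E|].
  apply RInt_le; [lra | | apply ex_RInt_cont, unif_cont |].
  - apply @ex_RInt_plus; apply @ex_RInt_scal; apply ex_RInt_cont, unif_cont.
  - intros s Hs. unfold plus, scal; simpl; unfold mult; simpl.
    replace (tau * (s * s ^ N * exp (- (t * (1 - s)))) + (1 - tau) * (s ^ N * exp (- (t * (1 - s)))))
      with (s ^ N * exp (- (t * (1 - s))) * (1 + - (tau * (1 - s)))) by ring.
    replace (- ((t + xi) * (1 - s))) with (- (t * (1 - s)) + - (xi * (1 - s))) by ring.
    rewrite exp_plus, <- Rmult_assoc.
    apply Rmult_le_compat_l.
    + apply Rmult_le_pos; [apply pow_le; lra | left; apply exp_pos].
    + apply Rle_trans with (1 + - (xi * (1 - s))); [nra | apply exp_ineq1_le].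
Qed.

(** * Splitting fair coins off the summands *)

Lemma pmf_summable f : is_pmf f -> l1 f /\ norm1 f = 1.
Proof. intros [H0 H1]. now apply l1_ge0. Qed.

(** Take [u k] to be the minimum of [f k] and [f (k + 1)], spread evenly over [k] and [k + 1]. A
    point [k] then gives away the average of [u k] and [u (k - 1)], both at most [f k], so the rest
    [v] is nonnegative. The mass of [u] follows from [|x - y| = x + y - 2 min x y]. *)
Lemma overlap_split f :
  is_pmf f ->
  exists u v, f = (kap * u + v)%fps /\ l1 u /\ l1 v /\
    norm1 u = 1 - dTV f (shift1 f) /\ norm1 v = dTV f (shift1 f).
Proof.
  intros [H0 H1].
  set (u := fun k => Rmin (f k) (f (S k))).
  set (v := fun k => f k - 1 / 2 * (u k + shift1 u k)).
  assert (Hu0 : forall k, 0 <= u k) by (intros k; unfold u; apply Rmin_glb; auto).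
  assert (Hex : ex_series u).
  { apply @ex_series_le with f; [|now exists 1].
    intros k. unfold norm; simpl; unfold abs; simpl. rewrite Rabs_pos_eq by auto.
    apply Rmin_l. }
  assert (Hu : is_series u (Series u)) by now apply Series_correct.
  destruct (l1_ge0 u _ Hu0 Hu) as [Lu Nu].
  pose proof is_series_shift1 as Hsh.
  assert (Hd : is_series (fun k => Rabs (f k - shift1 f k)) (1 + 1 - 2 * Series u)).
  { apply is_series_ext with (fun k => minus (plus (f k) (shift1 f k)) (scal 2 (shift1 u k))).
    - intros k. unfold minus, plus, opp, scal; simpl; unfold mult; simpl.
      destruct k as [|k]; simpl.
      + rewrite Rminus_0_r, Rabs_pos_eq by auto. eqR. ring.
      + eqR. unfold u, Rmin. destruct (Rle_dec (f k) (f (S k))).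
        * rewrite Rabs_pos_eq; lra.
        * rewrite Rabs_left1; lra.
    - apply @is_series_minus; [apply @is_series_plus; auto|].
      apply @is_series_scal. auto. }
  assert (Htau : dTV f (shift1 f) = 1 - Series u).
  { unfold dTV. rewrite (is_series_unique _ _ Hd). field. }
  assert (Hv0 : forall k, 0 <= v k).
  { intros [|k]; unfold v, u; simpl.
    - pose proof (Rmin_l (f O) (f 1%nat)). pose proof (H0 O). lra.
    - pose proof (Rmin_r (f k) (f (S k))). pose proof (Rmin_l (f (S k)) (f (S (S k)))). lra. }
  assert (Hv : is_series v (1 - Series u)).
  { replace (1 - Series u) with (1 - 1 / 2 * (Series u + Series u)) by field.
    apply @is_series_minus; auto. apply (@is_series_scal R_AbsRing R_NormedModule (1 / 2) (fun k => u k + shift1 u k)).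
    apply @is_series_plus; auto. }
  destruct (l1_ge0 v _ Hv0 Hv) as [Lv Nv].
  exists u, v. repeat split; auto; try lra.
  apply functional_extensionality. intros k. unfold padd. rewrite kap_mult. unfold v. ring.
Qed.

(** [N] counts the coins already collected. It must vary in the induction, because the last summand
    contributes a coin on its part [u] and none on its part [v]. *)
Lemma conv_all_smooth n f N :
  (forall i, (i < n)%nat -> is_pmf (f i)) ->
  l1 ((1 - pX) * (1 - pX) * kap_pow N * conv_all n f)%fps /\
  norm1 ((1 - pX) * (1 - pX) * kap_pow N * conv_all n f)%fps
    <= 16 / 3 * unif N (sumR n (fun i => Rmin (1 / 2) (1 - dTV (f i) (shift1 (f i))))).
Proof.
  revert N. induction n as [|n IH]; intros N Hf; cbn [conv_all sumR].
  - rewrite unif_0.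
    replace ((1 - pX) * (1 - pX) * kap_pow N * 1)%fps
      with ((1 - pX) * (1 - pX) * kap_pow N)%fps by ring.
    apply kap_pow_variation2.
  - destruct (overlap_split (f n)) as [u [v [E [Lu [Lv [Nu Nv]]]]]]; auto.
    set (Psi := sumR n _) in *. set (Y := conv_all n f) in *.
    destruct (IH N) as [H1 H2]; auto. destruct (IH (S N)) as [H3 H4]; auto.
    replace ((1 - pX) * (1 - pX) * kap_pow N * (Y * f n))%fps
      with ((1 - pX) * (1 - pX) * kap_pow (S N) * Y * u
            + (1 - pX) * (1 - pX) * kap_pow N * Y * v)%fps
      by (rewrite E; cbn [kap_pow]; ring).
    destruct (l1_mult _ _ H3 Lu) as [H5 H6]. destruct (l1_mult _ _ H1 Lv) as [H7 H8].
    destruct (l1_plus _ _ H5 H7) as [H9 H10]. split; auto.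
    set (xi := Rmin (1 / 2) (1 - dTV (f n) (shift1 (f n)))).
    pose proof (unif_mix N Psi (norm1 u) xi) as Hmix.
    assert (Hxi : xi <= norm1 u) by (rewrite Nu; apply Rmin_r).
    specialize (Hmix Hxi). pose proof (norm1_ge0 _ Lu). pose proof (norm1_ge0 _ Lv).
    assert (Euv : norm1 v = 1 - norm1 u) by lra.
    rewrite Euv in *. nra.
Qed.

Lemma second_difference_bound n f :
  (forall i, (i < n)%nat -> is_pmf (f i)) ->
  let Psi := sumR n (fun i => Rmin (1 / 2) (1 - dTV (f i) (shift1 (f i)))) in
  0 < Psi ->
  l1 ((1 - pX) * (1 - pX) * conv_all n f)%fps /\
  norm1 ((1 - pX) * (1 - pX) * conv_all n f)%fps <= 16 / 3 / Psi.
Proof.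
  intros Hf Psi HPsi.
  destruct (conv_all_smooth n f 0 Hf) as [H1 H2]. fold Psi in H2.
  cbn [kap_pow] in *.
  replace ((1 - pX) * (1 - pX) * conv_all n f)%fps
    with ((1 - pX) * (1 - pX) * 1 * conv_all n f)%fps by ring.
  split; auto. pose proof (unif_le Psi HPsi). unfold Rdiv at 1. nra.
Qed.

(** * Logarithmic derivatives and moment conditions *)

Lemma CV_radius_ge a r : 0 < r -> ex_series (fun n => a n * r ^ n) -> Rbar_le r (CV_radius a).
Proof.
  intros Hr Hs. apply Rbar_not_lt_le. intros Hc.
  apply (CV_disk_outside a r).
  - now rewrite Rabs_pos_eq by lra.
  - now apply ex_series_lim_0.
Qed.

(** The expansion is assumed only near 0, but equality of power series on a small disk identifies
    their coefficients, and from then on the identity is purely formal. *)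
Lemma logderiv_recurrence f a :
  is_pmf f -> logderiv_expansion f a -> pderiv f = (f * (fun m => a (S m)))%fps.
Proof.
  intros [Hf0 Hf1] [d [Hd Ha]]. set (a' := fun m => a (S m)).
  (* The series of [f] converges at 1 and that of [a'] strictly inside radius [d], so both converge
     at [r]. *)
  set (r := Rmin 1 (d / 2)).
  assert (Hr : 0 < r /\ r <= 1 /\ r < d).
  { unfold r. split; [apply Rmin_glb_lt; lra|].
    split; [apply Rmin_l|]. pose proof (Rmin_r 1 (d / 2)). lra. }
  assert (Cf : Rbar_le r (CV_radius f)).
  { apply Rbar_le_trans with 1; [simpl; lra|].
    apply CV_radius_ge; [lra|]. apply ex_series_ext with f; [|now exists 1].
    intros n. rewrite pow1. symmetry. apply Rmult_1_r. }
  assert (Ca : Rbar_le r (CV_radius a')).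
  { apply CV_radius_ge; [lra|].
    destruct (Ha r) as [_ H]; [rewrite Rabs_pos_eq; lra|]. eexists; exact H. }
  assert (Hlt : forall c z, Rbar_le r (CV_radius c) -> Rabs z < r ->
                  Rbar_lt (Rabs z) (CV_radius c)).
  { intros c z Hc Hz. apply Rbar_lt_le_trans with r; auto. }
  apply functional_extensionality. intros n.
  transitivity (PS_mult f a' n).
  2:{ unfold PS_mult, conv. now rewrite <- sum_n_Reals, sum_n_sumR. }
  transitivity (PS_derive f n).
  { unfold pderiv, PS_derive. now rewrite S_INR. }
  apply PSeries_ext_recip.
  - rewrite CV_radius_derive. apply Rbar_lt_le_trans with r; auto. simpl; lra.
  - apply Rbar_lt_le_trans with (r / 2); [simpl; lra|].
    apply CV_radius_ge; [lra|]. apply ex_pseries_R.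
    apply ex_pseries_mult; apply Hlt; auto; rewrite Rabs_pos_eq; lra.
  - exists (mkposreal r (proj1 Hr)). intros z Hz.
    assert (Hz' : Rabs z < r).
    { unfold ball in Hz; simpl in Hz. unfold AbsRing_ball, abs, minus, plus, opp in Hz.
      simpl in Hz. rewrite Ropp_0, Rplus_0_r in Hz. exact Hz. }
    rewrite PSeries_mult by (apply Hlt; auto).
    rewrite <- Derive_PSeries by (apply Hlt; auto).
    destruct (Ha z) as [Hne Hs]; [lra|].
    replace (PSeries a' z) with (Derive (pgf f) z / pgf f z)
      by (symmetry; apply is_series_unique, Hs).
    change (PSeries f) with (pgf f). field. exact Hne.
Qed.

Lemma conv_all_deriv n f (g : nat -> nat -> R) :
  (forall i, (i < n)%nat -> pderiv (f i) = (f i * g i)%fps) ->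
  pderiv (conv_all n f) = (conv_all n f * (fun l => sumR n (fun i => g i l)))%fps.
Proof.
  induction n as [|n IH]; intros H; cbn [conv_all sumR].
  - apply functional_extensionality. intros k. unfold pderiv.
    transitivity 0; [simpl; ring|]. symmetry.
    change (conv delta0 (fun _ => 0) k = 0). now rewrite conv_1_l.
  - rewrite pderiv_mult, IH, (H n) by auto.
    change (fun l => sumR n (fun i => g i l) + g n l)
      with ((fun l => sumR n (fun i => g i l)) + g n)%fps.
    ring.
Qed.

Lemma conv_pmf f g : is_pmf f -> is_pmf g -> is_pmf (conv f g).
Proof.
  intros Hf Hg. split.
  - intros k. apply sumR_ge0. intros. apply Rmult_le_pos; [apply Hf | apply Hg].
  - replace 1 with (1 * 1) by ring.
    apply is_series_conv; try apply Hf; try apply Hg; now apply pmf_summable.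
Qed.

Lemma conv_all_pmf n f : (forall i, (i < n)%nat -> is_pmf (f i)) -> is_pmf (conv_all n f).
Proof.
  induction n as [|n IH]; intros H; cbn [conv_all].
  - split; [intros [|k]; simpl; lra|]. rewrite <- pC_1. apply is_series_C.
  - apply conv_pmf; auto.
Qed.

(** * Division by powers of [1 - X] under moment conditions *)

Definition psum (b : nat -> R) (j : nat) := sumR (S j) b.

Lemma psum_spec b : b = ((1 - pX) * psum b)%fps.
Proof.
  apply functional_extensionality. intros k. rewrite one_minus_X_mult.
  destruct k as [|k]; unfold psum; simpl; ring.
Qed.

Lemma sumR_by_parts (om om1 b : nat -> R) N :
  om1 O = 0 -> (forall j, om1 (S j) = om1 j + om j) ->
  sumR N (fun j => om j * sumR (S j) b) = om1 N * sumR N b - sumR N (fun l => om1 l * b l).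
Proof.
  intros H0 HS. induction N as [|N IH]; [simpl; ring|].
  change (sumR (S N) ?F) with (sumR N F + F N). cbv beta. rewrite IH.
  change (sumR (S N) b) with (sumR N b + b N). rewrite HS. ring.
Qed.

(** Increasing weights may be moved inside the tail sum. This bounds the boundary terms of the
    summations by parts below by the remainder of a convergent series. *)
Lemma tail_weight_bound (om1 b : nat -> R) N s :
  (forall j, 0 <= om1 j) -> (forall j, om1 j <= om1 (S j)) ->
  is_series b s -> l1 b -> ex_series (fun l => om1 l * Rabs (b l)) ->
  om1 N * Rabs (s - sumR N b)
    <= Series (fun l => om1 l * Rabs (b l)) - sumR N (fun l => om1 l * Rabs (b l)).
Proof.
  intros H0 Hinc Hs Hb Hw.
  set (S1 := Series _).
  assert (Hlim1 : is_lim_seq (fun M => om1 N * Rabs (sumR (M + N) b - sumR N b))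
                    (om1 N * Rabs (s - sumR N b))).
  { apply is_series_sumR_lim in Hs. apply (is_lim_seq_scal_l _ (om1 N) (Rabs (s - sumR N b))).
    apply (is_lim_seq_abs _ (s - sumR N b)).
    apply is_lim_seq_minus'; [|apply is_lim_seq_const].
    now apply (is_lim_seq_incr_n (fun n => sumR n b) N). }
  assert (Hlim2 : is_lim_seq (fun M => sumR (M + N) (fun l => om1 l * Rabs (b l))
                                        - sumR N (fun l => om1 l * Rabs (b l)))
                    (S1 - sumR N (fun l => om1 l * Rabs (b l)))).
  { apply is_lim_seq_minus'; [|apply is_lim_seq_const].
    apply (is_lim_seq_incr_n (fun n => sumR n (fun l => om1 l * Rabs (b l))) N).
    apply is_series_sumR_lim. now apply Series_correct. }
  refine (is_lim_seq_le _ _ _ _ _ Hlim1 Hlim2).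
  intros M. simpl.
  assert (Hmono : forall i, om1 N <= om1 (i + N)%nat).
  { induction i as [|i IH]; simpl; [lra|]. specialize (Hinc (i + N)%nat). lra. }
  induction M as [|M IH]; simpl.
  - rewrite !Rminus_diag, Rabs_R0. lra.
  - specialize (Hmono M). specialize (H0 N).
    pose proof (Rabs_triang (sumR (M + N) b - sumR N b) (b (M + N)%nat)) as Ht.
    replace (sumR (M + N) b + b (M + N)%nat - sumR N b)
      with (sumR (M + N) b - sumR N b + b (M + N)%nat) by ring.
    pose proof (Rabs_pos (b (M + N)%nat)). nra.
Qed.

(** Since [b] sums to zero, [psum b j] is minus the tail beyond [j]. After absolute values are
    taken, each [b l] is counted with the total weight of all [j < l], which is [om1 l]. *)
Lemma psum_weighted (om om1 b : nat -> R) :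
  (forall j, 0 <= om j) -> om1 O = 0 -> (forall j, om1 (S j) = om1 j + om j) ->
  l1 b -> is_series b 0 -> ex_series (fun l => om1 l * Rabs (b l)) ->
  ex_series (fun j => om j * Rabs (psum b j)) /\
  Series (fun j => om j * Rabs (psum b j)) <= Series (fun l => om1 l * Rabs (b l)).
Proof.
  intros Hom H0 HS Hb Hb0 Hw.
  assert (Hinc : forall j, om1 j <= om1 (S j)).
  { intros j. rewrite HS. specialize (Hom j). lra. }
  assert (Hpos : forall j, 0 <= om1 j).
  { induction j as [|j IH]; [lra|]. specialize (Hinc j). lra. }
  assert (Hb' : is_series (fun k => Rabs (b k)) (norm1 b)) by now apply Series_correct.
  assert (Hw' : ex_series (fun l => om1 l * Rabs (Rabs (b l)))).
  { apply ex_series_ext with (2 := Hw). intros; now rewrite Rabs_Rabsolu. }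
  apply series_ge0_bounded.
  { intros i. apply Rmult_le_pos; [apply Hom | apply Rabs_pos]. }
  intros N.
  apply Rle_trans with (sumR N (fun j => om j * (norm1 b - sumR (S j) (fun k => Rabs (b k))))).
  - apply sumR_le. intros j _. apply Rmult_le_compat_l; [apply Hom|].
    pose proof (tail_weight_bound (fun _ => 1) b (S j) 0 ltac:(intros; lra) ltac:(intros; lra) Hb0 Hb) as Ht.
    rewrite Rmult_1_l in Ht. unfold psum.
    replace (Rabs (sumR (S j) b)) with (Rabs (0 - sumR (S j) b))
      by (rewrite Rminus_0_l; apply Rabs_Ropp).
    eapply Rle_trans; [apply Ht|].
    + apply ex_series_ext with (2 := Hb). intros; symmetry; apply Rmult_1_l.
    + right. f_equal.
      * apply Series_ext. intros; ring.
      * apply sumR_ext. intros; ring.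
  - rewrite (sumR_ext _ _ (fun j => om j * norm1 b - om j * sumR (S j) (fun k => Rabs (b k))))
      by (intros; ring).
    assert (E : sumR N (fun j => om j * norm1 b - om j * sumR (S j) (fun k => Rabs (b k)))
        = om1 N * norm1 b - sumR N (fun j => om j * sumR (S j) (fun k => Rabs (b k)))).
    { clear - H0 HS. induction N as [|N IH]; [simpl; rewrite H0; ring|].
      change (sumR (S N) ?F) with (sumR N F + F N). cbv beta. rewrite IH, HS. ring. }
    rewrite E, (sumR_by_parts om om1) by auto.
    pose proof (tail_weight_bound om1 (fun k => Rabs (b k)) N (norm1 b) Hpos Hinc Hb') as Ht.
    assert (Hl : l1 (fun k => Rabs (b k))).
    { apply ex_series_ext with (2 := Hb). intros; now rewrite Rabs_Rabsolu. }
    specialize (Ht Hl Hw').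
    rewrite (Series_ext _ (fun l => om1 l * Rabs (b l))) in Ht
      by (intros; now rewrite Rabs_Rabsolu).
    rewrite (sumR_ext N (fun l => om1 l * Rabs (Rabs (b l))) (fun l => om1 l * Rabs (b l))) in Ht
      by (intros; now rewrite Rabs_Rabsolu).
    rewrite Rabs_pos_eq in Ht; [lra|].
    pose proof (sumR_le_norm1 b N Hb). lra.
Qed.

(** Each division by [1 - X] thus uses up the vanishing sum and turns the moment with weight [om1]
    into the one with weight [om]. *)
Lemma psum_sum (om om1 b : nat -> R) s :
  (forall j, 0 <= om j) -> om1 O = 0 -> (forall j, om1 (S j) = om1 j + om j) ->
  l1 b -> is_series b 0 -> ex_series (fun l => om1 l * Rabs (b l)) ->
  is_series (fun l => om1 l * b l) s -> is_series (fun j => om j * psum b j) (- s).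
Proof.
  intros Hom H0 HS Hb Hb0 Hw Hs.
  assert (Hinc : forall j, om1 j <= om1 (S j)).
  { intros j. rewrite HS. specialize (Hom j). lra. }
  assert (Hpos : forall j, 0 <= om1 j).
  { induction j as [|j IH]; [lra|]. specialize (Hinc j). lra. }
  apply is_series_sumR_lim.
  apply is_lim_seq_ext with (fun N => om1 N * sumR N b - sumR N (fun l => om1 l * b l)).
  { intros N. symmetry. now apply sumR_by_parts. }
  replace (Finite (- s)) with (Finite (0 - s)) by (f_equal; ring).
  apply is_lim_seq_minus'; [|now apply is_series_sumR_lim].
  apply is_lim_seq_abs_0.
  apply is_lim_seq_le_le with (fun _ => 0)
    (fun N => Series (fun l => om1 l * Rabs (b l)) - sumR N (fun l => om1 l * Rabs (b l))).
  - intros N. split; [apply Rabs_pos|].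
    rewrite Rabs_mult, (Rabs_pos_eq (om1 N)) by auto.
    replace (Rabs (sumR N b)) with (Rabs (0 - sumR N b))
      by (rewrite Rminus_0_l; apply Rabs_Ropp).
    now apply tail_weight_bound.
  - apply is_lim_seq_const.
  - set (v := Series _). replace (Finite 0) with (Finite (v - v)) by (f_equal; ring).
    apply is_lim_seq_minus'; [apply is_lim_seq_const|].
    apply is_series_sumR_lim. now apply Series_correct.
Qed.

(** The weights 1, [INR], [fall2], [fall3] are binomial coefficients [l] over 0, 1, 2, 3, each the
    cumulative sum of the one before, as [psum_weighted] requires. *)
Definition fall2 (l : nat) := INR l * (INR l - 1) / 2.
Definition fall3 (l : nat) := INR l * (INR l - 1) * (INR l - 2) / 6.

Lemma fall2_S j : fall2 (S j) = fall2 j + INR j.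
Proof. unfold fall2. rewrite S_INR. field. Qed.

Lemma fall3_S j : fall3 (S j) = fall3 j + fall2 j.
Proof. unfold fall3, fall2. rewrite S_INR. field. Qed.

Lemma fall2_ge0 j : 0 <= fall2 j.
Proof.
  induction j as [|j IH]; [unfold fall2; simpl; lra|].
  rewrite fall2_S. pose proof (pos_INR j). lra.
Qed.

Lemma fall3_ge0 j : 0 <= fall3 j.
Proof.
  induction j as [|j IH]; [unfold fall3; simpl; lra|].
  rewrite fall3_S. pose proof (fall2_ge0 j). lra.
Qed.

(** The first three indices are skipped because [fall3] vanishes there; at index 3 the weights are
    3, 3 and 1 against [fall3 3 = 1], whence the factor 3. *)
Lemma weights_le_fall3 l :
  fall2 (S (S (S l))) <= 3 * fall3 (S (S (S l))) /\
  INR (S (S (S l))) <= 3 * fall3 (S (S (S l))) /\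
  1 <= 3 * fall3 (S (S (S l))).
Proof.
  unfold fall2, fall3. rewrite !S_INR. pose proof (pos_INR l) as H.
  set (t := INR l) in *. repeat split; nra.
Qed.

Lemma ex_series_tail_le (u v : nat -> R) N :
  (forall l, 0 <= u (N + l)%nat <= v (N + l)%nat) -> ex_series v -> ex_series u.
Proof.
  intros H Hv. apply (ex_series_incr_n u N).
  apply @ex_series_le with (fun l => v (N + l)%nat).
  - intros l. unfold norm; simpl; unfold abs; simpl. rewrite Rabs_pos_eq; apply H.
  - now apply (ex_series_incr_n v N).
Qed.

Lemma fall3_dominates b :
  ex_series (fun l => fall3 l * Rabs (b l)) ->
  l1 b /\ ex_series (fun l => INR l * Rabs (b l)) /\ ex_series (fun l => fall2 l * Rabs (b l)).
Proof.
  intros H.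
  assert (H3 : ex_series (fun l => 3 * (fall3 l * Rabs (b l)))) by now apply @ex_series_scal.
  repeat split; apply (ex_series_tail_le _ _ 3) with (2 := H3); intros l; cbn [Nat.add];
    destruct (weights_le_fall3 l) as [E1 [E2 E3]];
    pose proof (Rabs_pos (b (S (S (S l))))); pose proof (pos_INR (S (S (S l))));
    pose proof (fall2_ge0 (S (S (S l)))); split; nra.
Qed.

(** Three divisions by [1 - X]. Each one lowers every weight by one order, so the remaining moment
    conditions pass to the quotient and the weight [fall3] ends as the plain norm of [Q]. *)
Lemma third_order_factor b :
  ex_series (fun l => fall3 l * Rabs (b l)) ->
  is_series b 0 -> is_series (fun l => INR l * b l) 0 -> is_series (fun l => fall2 l * b l) 0 ->
  exists Q, b = ((1 - pX) * (1 - pX) * (1 - pX) * Q)%fps /\ l1 Q /\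
    norm1 Q <= Series (fun l => fall3 l * Rabs (b l)).
Proof.
  intros H3 S0 S1 S2. destruct (fall3_dominates b H3) as [H0 [H1 H2]].
  assert (one_S : forall j, INR (S j) = INR j + 1) by apply S_INR.
  assert (p1 : forall j : nat, 0 <= 1) by (intros; lra).
  assert (z2 : fall2 0 = 0) by (unfold fall2; simpl; field).
  assert (z3 : fall3 0 = 0) by (unfold fall3; simpl; field).
  assert (ext1 : forall g : nat -> R, ex_series (fun j => 1 * Rabs (g j)) -> l1 g).
  { intros g Hg. apply ex_series_ext with (2 := Hg). intros; apply Rmult_1_l. }
  assert (ext2 : forall (g : nat -> R) l, is_series (fun j => 1 * g j) l -> is_series g l).
  { intros g l Hg. apply is_series_ext with (2 := Hg). intros; apply Rmult_1_l. }
  set (c := psum b). set (e := psum c). set (Q := psum e).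
  destruct (psum_weighted (fun _ => 1) INR b) as [c0 _]; auto.
  destruct (psum_weighted INR fall2 b) as [c1 _]; auto using pos_INR, fall2_S.
  destruct (psum_weighted fall2 fall3 b) as [c2 c2']; auto using fall2_ge0, fall3_S.
  pose proof (psum_sum (fun _ => 1) INR b 0 p1 eq_refl one_S H0 S0 H1 S1) as sc0.
  pose proof (psum_sum INR fall2 b 0 pos_INR z2 fall2_S H0 S0 H2 S2) as sc1.
  rewrite Ropp_0 in sc0, sc1. apply ext2 in sc0. apply ext1 in c0. fold c in sc0, sc1, c0, c1, c2, c2'.
  destruct (psum_weighted (fun _ => 1) INR c) as [e0 _]; auto.
  destruct (psum_weighted INR fall2 c) as [e1 e1']; auto using pos_INR, fall2_S.
  pose proof (psum_sum (fun _ => 1) INR c 0 p1 eq_refl one_S c0 sc0 c1 sc1) as se0.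
  rewrite Ropp_0 in se0. apply ext2 in se0. apply ext1 in e0. fold e in se0, e0, e1, e1'.
  destruct (psum_weighted (fun _ => 1) INR e) as [q0 q0']; auto.
  apply ext1 in q0. fold Q in q0, q0'.
  exists Q. repeat split; auto.
  - rewrite (psum_spec b) at 1. fold c. rewrite (psum_spec c) at 1. fold e.
    rewrite (psum_spec e) at 1. fold Q. ring.
  - apply Rle_trans with (Series (fun j => 1 * Rabs (Q j))); [|lra].
    right. apply Series_ext. intros; ring.
Qed.

(** * Two bounds on the total variation distance *)

Definition geom (x : R) (k : nat) : R := x ^ k.

Lemma geom_inv x : ((1 - pC x * pX) * geom x)%fps = delta0.
Proof.
  apply functional_extensionality. intros k. rewrite <- pC_1, lin_mult.
  destruct k as [|k]; unfold geom; simpl; ring.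
Qed.

Lemma is_series_geom_pos x : 0 < x < 1 -> is_series (geom x) (/ (1 - x)).
Proof. intros Hx. apply is_series_geom. rewrite Rabs_pos_eq; lra. Qed.

Lemma l1_geom x : 0 < x < 1 -> l1 (geom x) /\ norm1 (geom x) = / (1 - x).
Proof.
  intros Hx. apply l1_ge0; [|now apply is_series_geom_pos].
  intros k. apply pow_le. lra.
Qed.

Lemma geom_difference x : ((1 - pX) * geom x = 1 - pC (1 - x) * (pX * geom x))%fps.
Proof.
  rewrite pC_minus, pC_1.
  transitivity ((1 - pC x * pX) * geom x - (1 - pC x) * (pX * geom x))%fps; [ring|].
  now rewrite geom_inv.
Qed.

Lemma l1_X_geom x : 0 < x < 1 -> l1 (pX * geom x)%fps /\ norm1 (pX * geom x)%fps <= / (1 - x).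
Proof.
  intros Hx. destruct (l1_geom x Hx) as [H1 H2].
  destruct (l1_mult _ _ l1_X H1) as [H3 H4]. split; auto.
  destruct (l1_ge0 pX 1 pX_ge0 is_series_X) as [_ E]. rewrite E, H2 in H4. lra.
Qed.

Lemma norm1_geom_difference x :
  0 < x < 1 -> l1 ((1 - pX) * geom x)%fps /\ norm1 ((1 - pX) * geom x)%fps <= 2.
Proof.
  intros Hx. rewrite geom_difference. destruct (l1_X_geom x Hx) as [H1 H2].
  destruct (l1_C_mult (1 - x) _ H1) as [H3 H4].
  destruct (l1_minus _ _ l1_one H3) as [H5 H6]. split; auto.
  destruct (l1_C 1) as [_ H7]. rewrite pC_1, Rabs_R1 in H7.
  rewrite Rabs_pos_eq in H4 by lra.
  assert ((1 - x) * norm1 (pX * geom x)%fps <= (1 - x) * / (1 - x))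
    by (apply Rmult_le_compat_l; lra).
  rewrite Rinv_r in * by lra. lra.
Qed.

(** Passing to cumulative weights multiplies the generating function by [x X / (1 - x X)], whose
    coefficients sum to [x / (1 - x)]. *)
Lemma is_series_geom_weight (om om1 : nat -> R) x s :
  0 < x < 1 -> (forall j, 0 <= om j) -> om1 O = 0 -> (forall j, om1 (S j) = om1 j + om j) ->
  is_series (fun l => om l * x ^ l) s -> is_series (fun l => om1 l * x ^ l) (s * (x / (1 - x))).
Proof.
  intros Hx Hom H0 HS Hs.
  destruct (l1_X_geom x Hx) as [Lg _]. destruct (l1_C_mult x _ Lg) as [Lg' _].
  assert (Sg : is_series (pC x * (pX * geom x))%fps (x / (1 - x))).
  { replace (x / (1 - x)) with (x * (1 * / (1 - x))) by (field; lra).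
    apply is_series_conv; auto; [apply is_series_C | | apply l1_C].
    apply is_series_conv; [apply is_series_X | now apply is_series_geom_pos
      | apply l1_X | now apply l1_geom]. }
  assert (L : l1 (fun l => om l * x ^ l)).
  { apply l1_ge0 with (2 := Hs). intros k. apply Rmult_le_pos; auto. apply pow_le; lra. }
  apply is_series_ext with (2 := is_series_conv _ _ _ _ Hs Sg L Lg').
  intros n. rewrite conv_C, conv_X. unfold conv. cbn [sumR]. rewrite Nat.sub_diag.
  simpl shift1. rewrite Rmult_0_r, Rmult_0_r, Rplus_0_r.
  assert (E : om1 n = sumR n om).
  { induction n as [|n IH]; [auto|]. rewrite HS, IH. reflexivity. }
  rewrite E, Rmult_comm, <- sumR_scal. apply sumR_ext. intros i Hi.
  destruct (n - i)%nat as [|d] eqn:Ed; [lia|]. simpl shift1. unfold geom.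
  replace n with (S d + i)%nat by lia. rewrite pow_add. simpl. ring.
Qed.

Lemma is_series_geom_INR x :
  0 < x < 1 -> is_series (fun l => INR l * x ^ l) (x / (1 - x) ^ 2).
Proof.
  intros Hx. replace (x / (1 - x) ^ 2) with (/ (1 - x) * (x / (1 - x))) by (field; lra).
  apply (is_series_geom_weight (fun _ => 1)); auto; [intros; lra | apply S_INR |].
  apply is_series_ext with (2 := is_series_geom_pos x Hx). intros; symmetry; apply Rmult_1_l.
Qed.

Lemma is_series_geom_fall2 x :
  0 < x < 1 -> is_series (fun l => fall2 l * x ^ l) (x ^ 2 / (1 - x) ^ 3).
Proof.
  intros Hx.
  replace (x ^ 2 / (1 - x) ^ 3) with (x / (1 - x) ^ 2 * (x / (1 - x))) by (field; lra).
  apply (is_series_geom_weight INR); auto using pos_INR, fall2_S, is_series_geom_INR.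
  unfold fall2; simpl; field.
Qed.

Lemma is_series_geom_fall3 x :
  0 < x < 1 -> is_series (fun l => fall3 l * x ^ l) (x ^ 3 / (1 - x) ^ 4).
Proof.
  intros Hx.
  replace (x ^ 3 / (1 - x) ^ 4) with (x ^ 2 / (1 - x) ^ 3 * (x / (1 - x))) by (field; lra).
  apply (is_series_geom_weight fall2); auto using fall2_ge0, fall3_S, is_series_geom_fall2.
  unfold fall3; simpl; field.
Qed.

Lemma pderiv_C_mult c g : pderiv (pC c * g)%fps = (pC c * pderiv g)%fps.
Proof. rewrite pderiv_mult, pderiv_C. ring. Qed.

Lemma pderiv_lin_mult a g :
  pderiv ((1 - pC a * pX) * g)%fps = ((1 - pC a * pX) * pderiv g - pC a * g)%fps.
Proof.
  rewrite pderiv_mult, pderiv_minus, pderiv_C_mult, pderiv_X, <- pC_1, pderiv_C, pC_1. ring.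
Qed.

(** * Two estimates of the distance to the law of [Z + W] *)

Section Comparison.
Context (al p ph : R).
Context (Hal : 0 < al) (Hp : 0 < p < 1) (Hph : 0 < ph < 1).
Let q := 1 - p.
Let qh := 1 - ph.

(* [v] is [(1 - q X) G_V], with [G_V] the logarithmic derivative of the pgf of [V]. *)
Definition vlog : nat -> R :=
  (pC qh * (1 - pC q * pX) * geom qh + pC (al * q))%fps.

(** A constant plus a geometric sequence: in this form the moments, and the absolute values of the
    coefficients beyond the zeroth, are explicit. *)
Lemma vlog_coeff : vlog = (pC ((al + 1) * q) + pC (qh - q) * geom qh)%fps.
Proof.
  unfold vlog. replace ((al + 1) * q) with (al * q + q) by ring.
  rewrite pC_plus, pC_minus.
  transitivity (pC qh * geom qh - pC q * (geom qh - (1 - pC qh * pX) * geom qh) + pC (al * q))%fps;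
    [ring|].
  rewrite geom_inv. ring.
Qed.

Context (y F : nat -> R).
Context (Hy : l1 y) (Hy1 : is_series y 1) (HF : l1 F).
Context (Heq : ((1 - pC q * pX) * pderiv y = vlog * y + (1 - pX) * F)%fps).

Let Z := nb_pmf al p.
Let W := ge_pmf ph.
Let D := (y - Z * W)%fps.

Local Lemma W_geom : W = (pC ph * geom qh)%fps.
Proof.
  rewrite conv_C. apply functional_extensionality. intros k. unfold W, ge_pmf, geom. apply Rmult_comm.
Qed.

Local Lemma Z_eq : ((1 - pC q * pX) * pderiv Z = pC (al * q) * Z)%fps.
Proof.
  apply functional_extensionality. intros k. rewrite <- pC_1, lin_mult, conv_C.
  unfold pderiv at 1. unfold Z. rewrite nb_pmf_S.
  replace (shift1 (pderiv (nb_pmf al p)) k) with (INR k * nb_pmf al p k).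
  - fold q. ring.
  - destruct k as [|k]; [simpl; ring|]. simpl shift1. unfold pderiv. now rewrite S_INR.
Qed.

Local Lemma Z_l1 : l1 Z /\ norm1 Z = 1.
Proof. apply l1_ge0; [intros; left; now apply nb_pmf_pos | now apply is_series_nb]. Qed.

Local Lemma W_l1 : l1 W /\ norm1 W = 1 /\ is_series W 1.
Proof.
  assert (H : is_series W 1).
  { rewrite W_geom. replace 1 with (ph * / (1 - qh)) by (unfold qh; field; lra).
    apply is_series_conv; [apply is_series_C | apply is_series_geom_pos | apply l1_C | apply l1_geom];
    unfold qh; lra. }
  destruct (l1_ge0 W 1) as [H1 H2]; auto.
  intros k. apply Rmult_le_pos; [apply pow_le; lra | lra].
Qed.

Local Lemma D_l1 : l1 D /\ is_series D 0.
Proof.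
  destruct Z_l1 as [Z1 _]. destruct W_l1 as [W1 [_ W2]].
  split; [apply l1_minus; auto; now apply l1_mult|].
  replace 0 with (1 - 1 * 1) by ring.
  apply @is_series_minus; auto. apply is_series_conv; auto. now apply is_series_nb.
Qed.

(** The quotient [y / W], compared with [Z], satisfies the negative binomial equation with source
    multiplied by [1 / W = 1 + m (1 - X)]. Multiplying the split solution back by [W] replaces
    [m (1 - X) W] by [qh (1 - X) geom qh], because [m * ph = qh], and no [1 / ph] remains. *)
Lemma tv_bound_nb :
  norm1 D / 2 <= (/ ((al + 1) * q) + 2 * qh * / ((al + 2) * q)) * norm1 F.
Proof.
  destruct Z_l1 as [Z1 _]. destruct W_l1 as [W1 [W2 W3]].
  set (m := qh / ph).
  set (d := (pC (/ ph) * (1 - pC qh * pX) * y - Z)%fps).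
  assert (Em1 : pC (/ ph) = (1 + pC m)%fps).
  { rewrite <- pC_1, <- pC_plus. f_equal. unfold m, qh. field. lra. }
  assert (Em2 : (pC (/ ph) * pC qh)%fps = pC m).
  { rewrite <- pC_mult. f_equal. unfold m. field. lra. }
  assert (Hg : l1 (pC (/ ph) * (1 - pC qh * pX))%fps).
  { apply l1_mult; [apply l1_C|]. apply l1_minus; [apply l1_one|].
    apply l1_mult; [apply l1_C | apply l1_X]. }
  assert (Hd : l1 d) by (apply l1_minus; auto; now apply l1_mult).
  assert (Hd0 : is_series d 0).
  { replace 0 with (/ ph * (1 - qh * 1) * 1 - 1) by (unfold qh; field; lra).
    apply @is_series_minus; [|now apply is_series_nb].
    apply is_series_conv; auto. apply is_series_conv; [apply is_series_C | | apply l1_C |].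
    - apply @is_series_minus; [rewrite <- pC_1; apply is_series_C|].
      apply is_series_conv; [apply is_series_C | apply is_series_X | apply l1_C | apply l1_X].
    - apply l1_minus; [apply l1_one|]. apply l1_mult; [apply l1_C | apply l1_X]. }
  assert (Ed : ((1 - pC q * pX) * pderiv d
     = pC (al * q) * d + (1 - pX) * ((1 + pC m * (1 - pX)) * F))%fps).
  { assert (Ec : (1 + pC m * (1 - pX) = pC (/ ph) * (1 - pC qh * pX))%fps).
    { transitivity ((1 + pC m) - pC m * pX)%fps; [ring|].
      rewrite <- Em1, <- Em2. ring. }
    rewrite Ec. unfold d.
    rewrite pderiv_minus, <- !conv_assoc, pderiv_C_mult, pderiv_lin_mult.
    transitivity (pC (/ ph) * ((1 - pC qh * pX) * ((1 - pC q * pX) * pderiv y)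
       - pC qh * (1 - pC q * pX) * y) - (1 - pC q * pX) * pderiv Z)%fps; [ring|].
    rewrite Heq, Z_eq. unfold vlog.
    transitivity (pC (/ ph) * (((1 - pC qh * pX) * geom qh) * pC qh * (1 - pC q * pX) * y
       + (1 - pC qh * pX) * (pC (al * q) * y + (1 - pX) * F)
       - pC qh * (1 - pC q * pX) * y) - pC (al * q) * Z)%fps; [ring|].
    rewrite geom_inv. ring. }
  destruct (stein_bound_split q al m d F) as [Ev [Cv [E [LE [LC [NE NC]]]]]]; auto;
    [unfold q; lra|].
  assert (ED : D = (W * Ev + pC qh * ((1 - pX) * geom qh) * Cv)%fps).
  { transitivity (W * d)%fps.
    - unfold D, d. rewrite W_geom.
      transitivity ((pC ph * pC (/ ph)) * (((1 - pC qh * pX) * geom qh) * y)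
         - Z * (pC ph * geom qh))%fps; [|ring].
      rewrite geom_inv, <- pC_mult, Rinv_r, pC_1 by lra. ring.
    - rewrite E.
      transitivity (W * Ev + pC m * (1 - pX) * W * Cv)%fps; [ring|].
      rewrite W_geom at 2.
      transitivity (W * Ev + (pC m * pC ph) * (1 - pX) * geom qh * Cv)%fps; [ring|].
      rewrite <- pC_mult. replace (m * ph) with qh by (unfold m; field; lra). ring. }
  destruct (norm1_geom_difference qh) as [G1 G2]; [unfold qh; lra|].
  destruct (l1_C_mult qh _ G1) as [G3 G4].
  destruct (l1_mult _ _ W1 LE) as [P1 P2]. destruct (l1_mult _ _ G3 LC) as [P3 P4].
  destruct (l1_plus _ _ P1 P3) as [P5 P6].
  rewrite ED. pose proof (norm1_ge0 _ LC). pose proof (norm1_ge0 _ G3).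
  rewrite W2 in P2. rewrite (Rabs_pos_eq qh) in G4 by (unfold qh; lra).
  assert (norm1 (pC qh * ((1 - pX) * geom qh))%fps * norm1 Cv <= (qh * 2) * (2 / ((al + 2) * q) * norm1 F)).
  { apply Rmult_le_compat; auto. apply Rle_trans with (1 := G4).
    apply Rmult_le_compat_l; [unfold qh; lra | auto]. }
  unfold Rdiv in *. lra.
Qed.

(** Multiplying the equation of [D] by [om = (1 - qh X) / (1 - q X)] makes [qh] the ratio of the
    Stein operator. The coefficient [al q om] is replaced by its value [al q ph / p] at 1; the
    difference is [(1 - X) U], which joins the source, and the norm of [U D] is finally moved to the
    left. *)
Lemma tv_bound_geom :
  norm1 D / 2 * (2 * qh + al * q * ph / p - 2 * (al * q * Rabs (q - qh) / p ^ 2))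
    <= (1 + Rabs (q - qh) / p) * norm1 F.
Proof.
  destruct D_l1 as [LD SD]. pose proof (norm1_ge0 _ LD) as ND.
  assert (Hq : 0 < q < 1) by (unfold q; lra). assert (Hqh : 0 < qh < 1) by (unfold qh; lra).
  set (om := (1 + pC (q - qh) * (pX * geom q))%fps).
  set (U := (pC (al * q * (q - qh) / p) * geom q)%fps).
  set (rt := qh + al * q * ph / p).
  assert (Eom : om = ((1 - pC qh * pX) * geom q)%fps).
  { unfold om. rewrite pC_minus.
    transitivity (((1 - pC q * pX) * geom q) + (pC q - pC qh) * (pX * geom q))%fps;
      [rewrite geom_inv; reflexivity | ring]. }
  assert (EW : ((1 - pC q * pX) * pderiv W = pC qh * (1 - pC q * pX) * geom qh * W)%fps).
  { assert (E : ((1 - pC qh * pX) * W = pC ph)%fps).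
    { rewrite W_geom. transitivity (pC ph * ((1 - pC qh * pX) * geom qh))%fps; [ring|].
      rewrite geom_inv. ring. }
    apply (f_equal pderiv) in E. rewrite pderiv_lin_mult, pderiv_C in E.
    assert (E2 : pderiv W = (geom qh * pC qh * W)%fps).
    { transitivity (geom qh * ((1 - pC qh * pX) * pderiv W - pC qh * W)
        + geom qh * pC qh * W + (1 - (1 - pC qh * pX) * geom qh) * pderiv W)%fps; [ring|].
      rewrite E, geom_inv. ring. }
    rewrite E2. ring. }
  assert (ED : ((1 - pC q * pX) * pderiv D = vlog * D + (1 - pX) * F)%fps).
  { unfold D. rewrite pderiv_minus, pderiv_mult.
    transitivity ((1 - pC q * pX) * pderiv y
       - (((1 - pC q * pX) * pderiv Z) * W + Z * ((1 - pC q * pX) * pderiv W)))%fps; [ring|].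
    rewrite Heq, Z_eq, EW. unfold vlog. ring. }
  assert (EU : (pC (al * q) * om = pC (al * q * ph / p) - (1 - pX) * U)%fps).
  { unfold U, om.
    transitivity (pC (al * q * ph / p) - pC (al * q * (q - qh) / p) * ((1 - pX) * geom q))%fps; [|ring].
    rewrite geom_difference.
    replace (al * q * ph / p) with (al * q + al * q * (q - qh) / p)
      by (unfold q, qh; field; lra).
    transitivity (pC (al * q) + pC (al * q * (q - qh) / p * (1 - q)) * (pX * geom q))%fps.
    - replace (al * q * (q - qh) / p * (1 - q)) with ((al * q) * (q - qh)) by (unfold q; field; lra).
      rewrite !pC_mult. ring.
    - rewrite pC_plus, (pC_mult (al * q * (q - qh) / p) (1 - q)). ring. }
  assert (Eh : ((1 - pC qh * pX) * pderiv D
     = pC (rt / qh * qh) * D + (1 - pX) * (om * F - U * D))%fps).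
  { replace (rt / qh * qh) with rt by (field; lra).
    transitivity ((1 - pC qh * pX) * (((1 - pC q * pX) * geom q) * pderiv D))%fps;
      [rewrite geom_inv; ring|].
    transitivity ((1 - pC qh * pX) * geom q * ((1 - pC q * pX) * pderiv D))%fps; [ring|].
    rewrite ED, <- Eom. unfold vlog.
    transitivity (pC qh * (((1 - pC q * pX) * geom q) * ((1 - pC qh * pX) * geom qh)) * D
       + (pC (al * q) * om) * D + (1 - pX) * (om * F))%fps.
    { rewrite Eom. ring. }
    rewrite !geom_inv, EU. unfold rt. rewrite pC_plus. ring. }
  destruct (l1_X_geom q Hq) as [X1 X2]. destruct (l1_C_mult (q - qh) _ X1) as [X3 X4].
  destruct (l1_plus _ _ l1_one X3) as [O1 O2].
  destruct (l1_C 1) as [_ N1]. rewrite pC_1, Rabs_R1 in N1.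
  destruct (l1_geom q Hq) as [G1 G2].
  destruct (l1_C_mult (al * q * (q - qh) / p) _ G1) as [U1 U2].
  fold om in O1, O2. fold U in U1, U2. rewrite G2 in U2.
  destruct (l1_mult _ _ O1 HF) as [M1 M2]. destruct (l1_mult _ _ U1 LD) as [M3 M4].
  destruct (l1_minus _ _ M1 M3) as [M5 M6].
  assert (Hrt : 0 < rt).
  { unfold rt. assert (0 < al * q * ph / p) by
      (apply Rdiv_lt_0_compat; [repeat apply Rmult_lt_0_compat|]; lra). lra. }
  pose proof (stein_bound qh (rt / qh) D _ Hqh ltac:(apply Rdiv_lt_0_compat; lra) LD SD M5 Eh) as HB.
  assert (Om : norm1 om <= 1 + Rabs (q - qh) / p).
  { assert (Rabs (q - qh) * norm1 (pX * geom q)%fps <= Rabs (q - qh) * / p).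
    { apply Rmult_le_compat_l; [apply Rabs_pos|]. replace p with (1 - q) by (unfold q; ring). auto. }
    unfold Rdiv. lra. }
  assert (Un : norm1 U <= al * q * Rabs (q - qh) / p ^ 2).
  { eapply Rle_trans; [exact U2|]. right.
    unfold Rdiv. rewrite !Rabs_mult, (Rabs_pos_eq al), (Rabs_pos_eq q), (Rabs_pos_eq (/ p))
      by (try lra; left; apply Rinv_0_lt_compat; lra).
    replace (1 - q) with p by (unfold q; ring). field. lra. }
  pose proof (norm1_ge0 _ HF).
  assert (B1 : norm1 om * norm1 F <= (1 + Rabs (q - qh) / p) * norm1 F) by now apply Rmult_le_compat_r.
  assert (B2 : norm1 U * norm1 D <= al * q * Rabs (q - qh) / p ^ 2 * norm1 D) by now apply Rmult_le_compat_r.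
  replace ((rt / qh + 1) * qh) with (rt + qh) in HB by (field; lra).
  assert (HB2 : norm1 D * (rt + qh) <= 2 * norm1 (om * F - U * D)%fps).
  { apply Rmult_le_compat_r with (r := rt + qh) in HB; [|lra].
    replace (2 / (rt + qh) * norm1 (om * F - U * D)%fps * (rt + qh))
      with (2 * norm1 (om * F - U * D)%fps) in HB by (field; lra). exact HB. }
  unfold rt in HB2. lra.
Qed.
End Comparison.

(** * Choosing between the two estimates *)

(** The first bound gives [T * s <= (1 + 2 qh) * phi] with [s = (al + 1) * q]. This suffices unless
    [C = r q - |qh - q| qh / ph ^ 2] exceeds [s], which requires both [ph < p] and [1 / 2 < ph]. *)
Lemma combine_bounds al p ph T phi :
  0 < al -> 0 < p < 1 -> 0 < ph < 1 -> 0 <= T -> 0 <= phi ->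
  let q := 1 - p in
  let qh := 1 - ph in
  let r := al + 1 + (qh - q) / (q * ph) in
  T <= (/ ((al + 1) * q) + 2 * qh * / ((al + 2) * q)) * phi ->
  T * (2 * qh + al * q * ph / p - 2 * (al * q * Rabs (q - qh) / p ^ 2))
    <= (1 + Rabs (q - qh) / p) * phi ->
  0 < r * q - Rabs (qh - q) * qh / ph ^ 2 ->
  T * (r * q - Rabs (qh - q) * qh / ph ^ 2) <= 3 * phi.
Proof.
  intros Hal Hp Hph HT Hphi q qh r H2 H3 Hr.
  assert (Hq : 0 < q < 1) by (unfold q; lra). assert (Hqh : 0 < qh < 1) by (unfold qh; lra).
  set (s := (al + 1) * q). assert (Hs : 0 < s) by (unfold s; nra).
  assert (H2' : T * s <= (1 + 2 * qh) * phi).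
  { assert (E : (/ s + 2 * qh * / ((al + 2) * q)) * s <= 1 + 2 * qh).
    { replace ((/ s + 2 * qh * / ((al + 2) * q)) * s) with (1 + 2 * qh * ((al + 1) / (al + 2)))
        by (unfold s; field; lra).
      assert ((al + 1) / (al + 2) <= 1) by (apply Rle_div_l; lra). nra. }
    fold s in H2. nra. }
  assert (Er : r * q = s + (qh - q) / ph) by (unfold r, s; field; lra).
  rewrite Er in *.
  destruct (Rle_lt_dec p ph) as [Hle | Hlt].
  - assert ((qh - q) / ph <= 0).
    { apply Rle_div_l; unfold qh, q; lra. }
    assert (0 <= Rabs (qh - q) * qh / ph ^ 2).
    { apply Rdiv_le_0_compat; [|apply pow_lt; lra].
      apply Rmult_le_pos; [apply Rabs_pos | lra]. }
    assert (T * (s + (qh - q) / ph - Rabs (qh - q) * qh / ph ^ 2) <= T * s)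
      by (apply Rmult_le_compat_l; lra).
    nra.
  - rewrite (Rabs_left1 (q - qh)) in H3 by (unfold q, qh; lra).
    rewrite (Rabs_pos_eq (qh - q)) in * by (unfold q, qh; lra).
    (* For [ph < p] the quantity [C] is exactly [s + X], and [X] has the sign of [2 ph - 1]. *)
    set (X := (p - ph) * (2 * ph - 1) / ph ^ 2).
    assert (EX : s + (qh - q) / ph - (qh - q) * qh / ph ^ 2 = s + X)
      by (unfold X, qh, q; field; lra).
    rewrite EX in *.
    (* The threshold is equivalent to [(1 + 2 qh) * (s + X) <= 3 * s], which is what the first bound
       needs. Its failure bounds [s] in terms of [X] for the second. *)
    destruct (Rle_lt_dec ((3 - 2 * ph) * X) (2 * ph * s)) as [HX | HX].
    + assert (E : (1 + 2 * qh) * (s + X) <= 3 * s) by (unfold qh; nra).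
      apply Rmult_le_reg_l with s; auto.
      assert (T * s * (s + X) <= (1 + 2 * qh) * phi * (s + X)) by (apply Rmult_le_compat_r; lra).
      assert ((1 + 2 * qh) * (s + X) * phi <= 3 * s * phi) by (apply Rmult_le_compat_r; lra).
      lra.
    + set (d := p - ph). assert (Hd : 0 < d) by (unfold d; lra).
      replace (- (q - qh)) with d in H3 by (unfold d, q, qh; ring).
      assert (Hps : 0 < ph * s) by now apply Rmult_lt_0_compat; lra.
      assert (HX0 : 0 < X) by nra.
      assert (Hh : 1 / 2 < ph).
      { apply Rnot_le_lt. intros Hc. assert (X <= 0); [|lra].
        unfold X. apply Rle_div_l; [apply pow_lt; lra|]. nra. }
      set (N := 1 + d / p) in *.
      assert (Hdp : 0 < d / p) by (apply Rdiv_lt_0_compat; lra).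
      assert (E1 : d / p <= 1 - ph).
      { apply Rle_div_l; [lra|]. unfold d. nra. }
      (* The difference [(1 - ph) p ^ 2 - (p - ph)] factors as [(1 - p) (ph - (1 - ph) p)],
         nonnegative because [1 / 2 < ph]. *)
      assert (E2 : d / p ^ 2 <= 1 - ph).
      { apply Rle_div_l; [apply pow_lt; lra|]. unfold d.
        assert (0 <= (1 - p) * (ph - (1 - ph) * p)) by (apply Rmult_le_pos; nra). nra. }
      assert (E2' : 0 < d / p ^ 2) by (apply Rdiv_lt_0_compat; [lra | apply pow_lt; lra]).
      set (den := 2 * qh + al * q * ph / p - 2 * (al * q * d / p ^ 2)) in *.
      assert (EXd : X * ph ^ 2 = d * (2 * ph - 1)) by (unfold X, d; field; lra).
      assert (HXd : X <= d).
      { apply Rmult_le_reg_r with (ph ^ 2); [apply pow_lt; lra|]. rewrite EXd.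
        apply Rmult_le_compat_l; [lra|]. nra. }
      (* Substitute [al q = s - q], [ph = p - d] and [qh = q + d]. *)
      assert (Eden : 3 * den = 6 * q + 6 * d - (s - q) * (- 3 + 3 * (d / p) + 6 * (d / p ^ 2))).
      { unfold den, s, qh, d, q. field. lra. }
      (* The terms in [s] and [X] are compared with [6 d]; the remaining terms in [q] have a
         favourable sign. *)
      assert (Key : N * (s + X) <= 3 * den).
      { rewrite Eden. unfold N.
        assert (B1 : (- 2 + 4 * (d / p) + 6 * (d / p ^ 2)) * s <= (8 - 10 * ph) * s)
          by (apply Rmult_le_compat_r; lra).
        assert (B2 : (1 + d / p) * X <= (2 - ph) * X) by (apply Rmult_le_compat_r; lra).
        assert (B3 : (8 - 10 * ph) * s + (2 - ph) * X <= 6 * d).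
        { destruct (Rle_lt_dec (8 - 10 * ph) 0) as [Hn | Hn].
          - assert ((8 - 10 * ph) * s <= 0) by nra. nra.
          (* The multiplier clears [2 ph] from the bound on [s] and [ph ^ 2] from [X], leaving an
             inequality in [ph] alone. *)
          - apply Rmult_le_reg_r with (2 * ph ^ 3); [assert (0 < ph ^ 3) by (apply pow_lt; lra); lra|].
            assert (C1 : (8 - 10 * ph) * (2 * ph * s) <= (8 - 10 * ph) * ((3 - 2 * ph) * X))
              by (apply Rmult_le_compat_l; lra).
            assert (C2 : ph ^ 2 * ((8 - 10 * ph) * (2 * ph * s))
                 <= ph ^ 2 * ((8 - 10 * ph) * ((3 - 2 * ph) * X)))
              by (apply Rmult_le_compat_l; [apply pow2_ge_0 | lra]).
            apply Rle_trans with
              ((8 - 10 * ph) * (3 - 2 * ph) * (X * ph ^ 2) + 2 * ph * (2 - ph) * (X * ph ^ 2)); [nra|].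
            rewrite EXd.
            assert (P : (2 * ph - 1) * ((8 - 10 * ph) * (3 - 2 * ph) + 2 * ph * (2 - ph)) <= 12 * ph ^ 3).
            { replace ((8 - 10 * ph) * (3 - 2 * ph) + 2 * ph * (2 - ph))
                with (6 * (1 - ph) * (4 - 3 * ph)) by ring.
              (* In [u] the claim becomes, up to a positive factor,
                 [0 <= 1 - 2 u + 11 u ^ 2 - 2 u ^ 3]. *)
              set (u := 2 * ph - 1). replace ph with ((1 + u) / 2) by (unfold u; field).
              assert (0 < u < 3 / 5) by (unfold u; lra). nra. }
            assert (d * ((2 * ph - 1) * ((8 - 10 * ph) * (3 - 2 * ph) + 2 * ph * (2 - ph)))
               <= d * (12 * ph ^ 3)) by (apply Rmult_le_compat_l; lra).
            lra. }
        assert (B4 : 0 <= q * (d / p)) by (apply Rmult_le_pos; lra).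
        assert (B5 : 0 <= q * (d / p ^ 2)) by (apply Rmult_le_pos; lra).
        nra. }
      assert (HN : 0 < N) by (unfold N; lra).
      apply Rmult_le_reg_l with N; auto.
      assert (T * (N * (s + X)) <= T * (3 * den)) by (apply Rmult_le_compat_l; auto).
      lra.
Qed.

(** * Cumulant matching and moments of the residual *)

(** Expanding, [z ^ 3 + 3 e1 z = e1 ^ 3 / x ^ 3 - x ^ 3]; this equals [- e2] because [x ^ 3] is a
    root of [s ^ 2 = e2 s + e1 ^ 3]. *)
Lemma cardano e1 e2 :
  let Dl := 4 * e1 ^ 3 + e2 ^ 2 in
  0 <= Dl -> 0 < (e2 + sqrt Dl) / 2 ->
  let x := Rpower ((e2 + sqrt Dl) / 2) (1 / 3) in
  let z := e1 / x - x in z ^ 3 + 3 * e1 * z + e2 = 0.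
Proof.
  intros Dl HD Hs x z.
  set (s := (e2 + sqrt Dl) / 2) in *.
  assert (Hx : 0 < x) by apply exp_pos.
  assert (Ex : x ^ 3 = s).
  { rewrite <- Rpower_pow by auto. unfold x. rewrite Rpower_mult.
    replace (1 / 3 * INR 3) with 1 by (simpl; field). now apply Rpower_1. }
  assert (E : s ^ 2 = e2 * s + e1 ^ 3).
  { pose proof (sqrt_sqrt Dl HD) as Hq. unfold s.
    replace (((e2 + sqrt Dl) / 2) ^ 2) with ((e2 ^ 2 + 2 * e2 * sqrt Dl + sqrt Dl * sqrt Dl) / 4) by field.
    rewrite Hq. unfold Dl. field. }
  unfold z.
  replace ((e1 / x - x) ^ 3 + 3 * e1 * (e1 / x - x) + e2) with ((e1 ^ 3 - (x ^ 3) ^ 2 + e2 * x ^ 3) / x ^ 3)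
    by (field; lra).
  rewrite Ex, E. field. lra.
Qed.

(** Once the geometric part is removed, [mu - e], [mu2 - e ^ 2] and [mu3 / 2 - e ^ 3] must form a
    geometric progression of ratio [q / p]. Equality of the squared middle term with the product of
    the outer ones is the cubic in [eta], since the fourth powers of [e] cancel. The conclusions
    have the shape of the moments in [increment_moments]. *)
Lemma cumulant_matching mu mu2 mu3 eta :
  0 < mu ->
  (eta - 2 * mu2) ^ 3 + 3 * (3 / 2 * mu * mu3 - 4 * mu2 ^ 2) * (eta - 2 * mu2)
    + (27 * mu ^ 2 * mu2 ^ 2 - 16 * mu2 ^ 3 - 27 / 2 * mu ^ 3 * mu3 + 9 * mu * mu2 * mu3) = 0 ->
  let e := eta / (3 * mu) in
  let al := (mu - e) ^ 2 / (mu2 - e ^ 2) in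
  let p := (mu - e) / (mu + mu2 - e * (e + 1)) in
  let q := 1 - p in
  0 < al -> 0 < p ->
  p * mu = al * q + p * e /\ p * mu2 - q * mu = p * e ^ 2 - q * e /\
  p * mu3 / 2 - q * mu2 = p * e ^ 3 - q * e ^ 2.
Proof.
  intros Hmu Hc e al p q Hal Hp.
  assert (Ee : eta = 3 * mu * e) by (unfold e; field; lra).
  assert (Hcub : (mu2 - e ^ 2) ^ 2 = (mu - e) * (mu3 / 2 - e ^ 3)).
  { apply Rminus_diag_uniq. apply Rmult_eq_reg_l with (27 * mu ^ 2); [|nra].
    rewrite Rmult_0_r, <- Hc, Ee. field. }
  (* Division by zero yields zero, so the positivity of [al] and [p] excludes vanishing
     denominators. *)
  assert (H2 : mu2 - e ^ 2 <> 0).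
  { intros H. unfold al, Rdiv in Hal. rewrite H, Rinv_0, Rmult_0_r in Hal. lra. }
  assert (H3 : mu + mu2 - e * (e + 1) <> 0).
  { intros H. unfold p, Rdiv in Hp. rewrite H, Rinv_0, Rmult_0_r in Hp. lra. }
  assert (H1 : mu - e <> 0).
  { intros H. unfold p, Rdiv in Hp. rewrite H, Rmult_0_l in Hp. lra. }
  assert (Eq : q = (mu2 - e ^ 2) / (mu + mu2 - e * (e + 1))) by (unfold q, p; field; auto).
  assert (I1 : al * q = p * (mu - e)) by (rewrite Eq; unfold al, p; field; auto).
  assert (I2 : q * (mu - e) = p * (mu2 - e ^ 2)) by (rewrite Eq; unfold p; field; auto).
  assert (I3 : q * (mu2 - e ^ 2) = p * (mu3 / 2 - e ^ 3)).
  { rewrite Eq. unfold p.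
    replace ((mu2 - e ^ 2) / (mu + mu2 - e * (e + 1)) * (mu2 - e ^ 2))
      with ((mu2 - e ^ 2) ^ 2 / (mu + mu2 - e * (e + 1))) by (field; auto).
    rewrite Hcub. field. auto. }
  repeat split; lra.
Qed.

Lemma moment_difference (om om' g : nat -> R) q s s' :
  (forall j, om' j = om (S j)) ->
  is_series (fun l => om l * g l) s -> is_series (fun l => om' l * g l) s' ->
  is_series (fun l => om l * (g l - q * shift1 g l)) (s - q * s').
Proof.
  intros HS Hs Hs'.
  apply is_series_ext with (fun l => minus (om l * g l) (scal q (shift1 (fun j => om' j * g j) l))).
  - intros [|l]; unfold minus, plus, opp, scal; simpl; unfold mult; simpl; eqR;
      [ring | rewrite HS; ring].
  - apply @is_series_minus; auto. apply @is_series_scal. now apply is_series_shift1.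
Qed.

Lemma is_series_sumR n (F : nat -> nat -> R) l :
  (forall i, (i < n)%nat -> is_series (F i) (l i)) ->
  is_series (fun k => sumR n (fun i => F i k)) (sumR n l).
Proof.
  intros H. rewrite (sumR_ext n l (fun i => Series (F i))).
  - apply Series_sumR. intros i Hi. exists (l i); auto.
  - intros i Hi. symmetry. apply is_series_unique; auto.
Qed.

Lemma vlog_moment al p ph (om : nat -> R) s :
  is_series (fun l => om l * (1 - ph) ^ l) s ->
  is_series (fun l => om l * vlog al p ph l)
    (om O * ((al + 1) * (1 - p)) + (p - ph) * s).
Proof.
  intros Hs.
  apply is_series_ext with
    (fun l => plus (pC (om O * ((al + 1) * (1 - p))) l) (scal (p - ph) (om l * (1 - ph) ^ l))).
  - intros l. rewrite vlog_coeff. unfold padd. rewrite conv_C.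
    replace (1 - ph - (1 - p)) with (p - ph) by ring.
    unfold plus, scal, geom; simpl; unfold mult; simpl. eqR.
    destruct l as [|l]; simpl; ring.
  - apply @is_series_plus; [apply is_series_C | now apply @is_series_scal].
Qed.

(** The sequence [b] is [(1 - q X) g], and the factor [1 - q X] mixes each factorial moment with the
    one of the next lower order only. *)
Lemma increment_moments (g : nat -> R) q :
  ex_series g -> ex_series (fun m => INR m * g m) ->
  ex_series (fun m => INR m * (INR m - 1) * g m) ->
  let s0 := Series g in
  let s1 := Series (fun m => INR m * g m) in
  let s2 := Series (fun m => INR m * (INR m - 1) * g m) in
  let b := fun l => g l - q * shift1 g l in
  is_series b ((1 - q) * s0) /\
  is_series (fun l => INR l * b l) ((1 - q) * s1 - q * s0) /\
  is_series (fun l => fall2 l * b l) ((1 - q) * s2 / 2 - q * s1).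
Proof.
  intros E0 E1 E2 s0 s1 s2 b.
  assert (S0 : is_series (fun m => 1 * g m) s0).
  { apply is_series_ext with g; [intros; symmetry; apply Rmult_1_l | now apply Series_correct]. }
  assert (S1 : is_series (fun m => INR m * g m) s1) by now apply Series_correct.
  assert (S2 : is_series (fun m => fall2 m * g m) (/ 2 * s2)).
  { apply is_series_ext with (fun m => scal (/ 2) (INR m * (INR m - 1) * g m)).
    - intros m. unfold scal, fall2; simpl; unfold mult; simpl. eqR. field.
    - apply @is_series_scal. now apply Series_correct. }
  assert (S1' : is_series (fun m => (INR m + 1) * g m) (s1 + s0)).
  { apply is_series_ext with (fun m => plus (INR m * g m) (1 * g m)).
    - intros m. unfold plus; simpl. eqR. ring.
    - now apply @is_series_plus. }
  assert (S2' : is_series (fun m => (fall2 m + INR m) * g m) (/ 2 * s2 + s1)).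
  { apply is_series_ext with (fun m => plus (fall2 m * g m) (INR m * g m)).
    - intros m. unfold plus; simpl. eqR. ring.
    - now apply @is_series_plus. }
  repeat split.
  - replace ((1 - q) * s0) with (s0 - q * s0) by ring.
    apply is_series_ext with (fun l => 1 * (g l - q * shift1 g l)); [intros; apply Rmult_1_l|].
    now apply (moment_difference (fun _ => 1) (fun _ => 1)).
  - replace ((1 - q) * s1 - q * s0) with (s1 - q * (s1 + s0)) by ring.
    apply (moment_difference INR (fun m => INR m + 1)); auto. intros; now rewrite S_INR.
  - replace ((1 - q) * s2 / 2 - q * s1) with (/ 2 * s2 - q * (/ 2 * s2 + s1)) by field.
    apply (moment_difference fall2 (fun m => fall2 m + INR m)); auto.
    intros; now rewrite fall2_S.
Qed.

(** If [mu] were nonpositive, the quotient would be nonpositive or greater than 1, according to the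
    sign of its denominator. *)
Lemma geometric_parameter mu eta :
  0 < eta -> 0 < 3 * mu / (3 * mu + eta) < 1 ->
  0 < mu /\ (1 - 3 * mu / (3 * mu + eta)) / (3 * mu / (3 * mu + eta)) = eta / (3 * mu).
Proof.
  intros He H.
  assert (Hz : 3 * mu + eta <> 0).
  { intros Hz. unfold Rdiv in H. rewrite Hz, Rinv_0, Rmult_0_r in H. lra. }
  assert (Hmu : 0 < mu).
  { apply Rnot_le_lt. intros Hc.
    destruct (Rle_lt_dec (3 * mu + eta) 0) as [Hn | Hn].
    - assert (Hv : 3 * mu / (3 * mu + eta) = 1 + eta / - (3 * mu + eta)) by (field; lra).
      assert (0 < eta / - (3 * mu + eta)) by (apply Rdiv_lt_0_compat; lra). lra.
    - assert (3 * mu / (3 * mu + eta) <= 0) by (apply Rle_div_l; lra). lra. }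
  split; auto. field. lra.
Qed.

(** * The residual in the recursion for [Y] and the final estimate *)

Theorem theorem3p3 (n : nat) (f : nat -> nat -> R) (a : nat -> nat -> R) :
  (forall i, (i < n)%nat -> is_pmf (f i)) ->
  (forall i, (i < n)%nat -> logderiv_expansion (f i) (a i)) ->
  (forall i, (i < n)%nat ->
     ex_series (fun m => a i (S m)) /\
     ex_series (fun m => (INR m + 1) * a i (S m)) /\
     ex_series (fun m => INR m * a i (S m)) /\
     ex_series (fun m => INR m * (INR m - 1) * a i (S m))) ->
  let mu := sumR n (fun i => Series (fun m => a i (S m))) in
  let sigma2 := sumR n (fun i => Series (fun m => (INR m + 1) * a i (S m))) in
  let mu2 := sumR n (fun i => Series (fun m => INR m * a i (S m))) in
  let mu3 := sumR n (fun i => Series (fun m => INR m * (INR m - 1) * a i (S m))) in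
  sigma2 > mu ->
  let eta1 := 3 / 2 * mu * mu3 - 4 * mu2 ^ 2 in
  let eta2 := 27 * mu ^ 2 * mu2 ^ 2 - 16 * mu2 ^ 3 - 27 / 2 * mu ^ 3 * mu3
              + 9 * mu * mu2 * mu3 in
  0 <= 4 * eta1 ^ 3 + eta2 ^ 2 ->
  0 < (eta2 + sqrt (4 * eta1 ^ 3 + eta2 ^ 2)) / 2 ->
  let eta3 := Rpower ((eta2 + sqrt (4 * eta1 ^ 3 + eta2 ^ 2)) / 2) (1 / 3) in
  let eta := 2 * mu2 + eta1 / eta3 - eta3 in
  0 < eta ->
  let ph := 3 * mu / (3 * mu + eta) in
  let alpha := (mu - eta / (3 * mu)) ^ 2 / (mu2 - eta ^ 2 / (9 * mu ^ 2)) in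
  let p := (mu - eta / (3 * mu)) /
           (sigma2 - eta / (3 * mu) * (eta / (3 * mu) + 1)) in
  0 < alpha -> 0 < p < 1 -> 0 < ph < 1 ->
  let q := 1 - p in
  let qh := 1 - ph in
  let r := alpha + 1 + (qh - q) / (q * ph) in
  let Psi := sumR n (fun i => Rmin (1 / 2) (1 - dTV (f i) (shift1 (f i)))) in
  0 < Psi ->
  (forall i, (i < n)%nat ->
     ex_series (fun l => INR l * (INR l - 1) * (INR l - 2) / 6
                         * Rabs (a i (S l) - q * a i l))) ->
  r * q > Rabs (qh - q) * qh / ph ^ 2 ->
  dTV (conv_all n f) (conv (nb_pmf alpha p) (ge_pmf ph))
  <= 16 / (Psi * (r * q - Rabs (qh - q) * qh / ph ^ 2)) *
     (sumR n (fun i => Series (fun l => INR l * (INR l - 1) * (INR l - 2) / 6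
                                        * Rabs (a i (S l) - q * a i l)))
      + Rabs (qh - q) * qh ^ 3 / ph ^ 4).
Proof.
  intros Hpmf Hlog Hex mu sigma2 mu2 mu3 Hsig eta1 eta2 HD Hs3 eta3 eta Heta ph al p
    Hal Hp Hph q qh r Psi HPsi Hb3 Hr.
  set (g := fun i m => a i (S m)).
  set (bi := fun i l => g i l - q * shift1 (g i) l).
  destruct (geometric_parameter mu eta Heta Hph) as [Hmu Eqh]. fold ph qh in Eqh.
  assert (Esig : sigma2 = mu + mu2).
  { unfold sigma2, mu, mu2. rewrite <- sumR_plus. apply sumR_ext. intros i Hi.
    destruct (Hex i Hi) as [E0 [_ [E1 _]]].
    rewrite <- Series_plus by auto. apply Series_ext. intros m. ring. }
  destruct (cumulant_matching mu mu2 mu3 eta Hmu) as [M0 [M1 M2]].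
  { pose proof (cardano eta1 eta2 HD Hs3) as Hc. cbv zeta in Hc. fold eta3 in Hc.
    replace (eta1 / eta3 - eta3) with (eta - 2 * mu2) in Hc by (unfold eta; ring).
    exact Hc. }
  { replace ((eta / (3 * mu)) ^ 2) with (eta ^ 2 / (9 * mu ^ 2)) by (field; lra). exact Hal. }
  { rewrite <- Esig. apply Hp. }
  replace ((eta / (3 * mu)) ^ 2) with (eta ^ 2 / (9 * mu ^ 2)) in M0 at 1 by (field; lra).
  rewrite <- Esig in M0, M1, M2. fold al p q in M0. fold p q in M1, M2. rewrite <- Eqh in M0, M1, M2.
  assert (Hq : 0 < q < 1) by (unfold q; lra). assert (Hqh : 0 < qh < 1) by (unfold qh; lra).
  set (y := conv_all n f).
  assert (Hy : is_pmf y) by now apply conv_all_pmf.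
  destruct (pmf_summable y Hy) as [Ly _].
  assert (Ey : pderiv y = (y * (fun l => sumR n (fun i => g i l)))%fps).
  { apply conv_all_deriv. intros i Hi. apply logderiv_recurrence; auto. }
  set (b := fun l => sumR n (fun i => bi i l) - vlog al p ph l).
  assert (Eb : ((1 - pC q * pX) * pderiv y = vlog al p ph * y + b * y)%fps).
  { rewrite Ey.
    transitivity (((1 - pC q * pX) * (fun l => sumR n (fun i => g i l))) * y)%fps; [ring|].
    transitivity ((vlog al p ph + b) * y)%fps; [|ring]. f_equal.
    apply functional_extensionality. intros l. rewrite <- pC_1, lin_mult.
    unfold padd, b, bi.
    rewrite (sumR_ext n (fun i => g i l - q * shift1 (g i) l)
               (fun i => g i l + (- q) * shift1 (g i) l)) by (intros; ring).
    rewrite sumR_plus, sumR_scal.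
    replace (sumR n (fun i => shift1 (g i) l)) with (shift1 (fun l => sumR n (fun i => g i l)) l).
    - ring.
    - destruct l as [|l]; simpl; [now rewrite sumR_zero | reflexivity]. }
  assert (Emom : forall i, (i < n)%nat -> _) by
    (intros i Hi; destruct (Hex i Hi) as [E0 [_ [E1 E2]]];
     exact (increment_moments (g i) q E0 E1 E2)).
  cbv zeta in Emom.
  (* Here and in [Sb1] and [Sb2], the moments of the [bi] come from [increment_moments] and those of
     [vlog] from geometric series; [M0], [M1] and [M2] make them cancel. *)
  assert (Sb0 : is_series b 0).
  { replace 0 with (sumR n (fun i => (1 - q) * Series (g i))
       - (1 * ((al + 1) * (1 - p)) + (p - ph) * / (1 - (1 - ph)))).
    - apply @is_series_minus.
      + apply is_series_sumR. intros i Hi. apply (Emom i Hi).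
      + apply is_series_ext with (fun l => 1 * vlog al p ph l); [intros; apply Rmult_1_l|].
        apply (vlog_moment al p ph (fun _ => 1)).
        apply is_series_ext with (geom (1 - ph)); [intros; symmetry; apply Rmult_1_l|].
        apply is_series_geom_pos. lra.
    - rewrite sumR_scal. change (sumR n (fun i => Series (g i))) with mu.
      replace (1 - q) with p by (unfold q; ring). rewrite M0. unfold q, qh. field. lra. }
  assert (Sb1 : is_series (fun l => INR l * b l) 0).
  { replace 0 with (sumR n (fun i => (1 - q) * Series (fun m => INR m * g i m) - q * Series (g i))
       - (INR 0 * ((al + 1) * (1 - p)) + (p - ph) * ((1 - ph) / (1 - (1 - ph)) ^ 2))).
    - apply is_series_ext with (fun l => minus (sumR n (fun i => INR l * bi i l)) (INR l * vlog al p ph l)).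
      { intros l. rewrite sumR_scal. unfold minus, plus, opp, b; simpl. eqR. ring. }
      apply @is_series_minus.
      + apply (is_series_sumR n (fun i l => INR l * bi i l)). intros i Hi. apply (Emom i Hi).
      + apply vlog_moment. apply is_series_geom_INR. lra.
    - rewrite (sumR_ext n _ (fun i => (1 - q) * Series (fun m => INR m * g i m) + - q * Series (g i)))
        by (intros; ring).
      rewrite sumR_plus, !sumR_scal. change (sumR n (fun i => Series (g i))) with mu.
      change (sumR n (fun i => Series (fun m => INR m * g i m))) with mu2.
      replace (1 - q) with p by (unfold q; ring).
      replace (p * mu2 + - q * mu) with (p * mu2 - q * mu) by ring. rewrite M1.
      unfold q, qh. simpl. field. lra. }
  assert (Sb2 : is_series (fun l => fall2 l * b l) 0).
  { replace 0 with (sumR n (fun i => (1 - q) * Series (fun m => INR m * (INR m - 1) * g i m) / 2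
         - q * Series (fun m => INR m * g i m))
       - (fall2 0 * ((al + 1) * (1 - p)) + (p - ph) * ((1 - ph) ^ 2 / (1 - (1 - ph)) ^ 3))).
    - apply is_series_ext with (fun l => minus (sumR n (fun i => fall2 l * bi i l)) (fall2 l * vlog al p ph l)).
      { intros l. rewrite sumR_scal. unfold minus, plus, opp, b; simpl. eqR. ring. }
      apply @is_series_minus.
      + apply (is_series_sumR n (fun i l => fall2 l * bi i l)). intros i Hi. apply (Emom i Hi).
      + apply vlog_moment. apply is_series_geom_fall2. lra.
    - rewrite (sumR_ext n _ (fun i => (1 - q) / 2 * Series (fun m => INR m * (INR m - 1) * g i m)
          + - q * Series (fun m => INR m * g i m))) by (intros; field).
      rewrite sumR_plus, !sumR_scal.
      change (sumR n (fun i => Series (fun m => INR m * g i m))) with mu2.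
      change (sumR n (fun i => Series (fun m => INR m * (INR m - 1) * g i m))) with mu3.
      replace (1 - q) with p by (unfold q; ring).
      replace (p / 2 * mu3 + - q * mu2) with (p * mu3 / 2 - q * mu2) by field. rewrite M2.
      unfold q, qh, fall2. simpl. field. lra. }
  set (w3 := fun i l => INR l * (INR l - 1) * (INR l - 2) / 6 * Rabs (a i (S l) - q * a i l)) in *.
  set (Bd := sumR n (fun i => Series (w3 i)) + Rabs (qh - q) * qh ^ 3 / ph ^ 4).
  assert (SBd : is_series (fun l => sumR n (fun i => w3 i l) + Rabs (qh - q) * (fall3 l * qh ^ l)) Bd).
  { apply @is_series_plus.
    - apply Series_sumR. auto.
    - replace (Rabs (qh - q) * qh ^ 3 / ph ^ 4) with (Rabs (qh - q) * (qh ^ 3 / (1 - qh) ^ 4))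
        by (replace (1 - qh) with ph by (unfold qh; ring); field; lra).
      apply (@is_series_scal R_AbsRing R_NormedModule). now apply is_series_geom_fall3. }
  assert (Hdom : forall l, 0 <= fall3 l * Rabs (b l)
            <= sumR n (fun i => w3 i l) + Rabs (qh - q) * (fall3 l * qh ^ l)).
  { intros l. pose proof (fall3_ge0 l) as H3. split; [apply Rmult_le_pos; auto; apply Rabs_pos|].
    apply Rle_trans with (fall3 l * (sumR n (fun i => Rabs (bi i l)) + Rabs (vlog al p ph l))).
    - apply Rmult_le_compat_l; auto. unfold b, Rminus.
      eapply Rle_trans; [apply Rabs_triang|]. rewrite Rabs_Ropp.
      apply Rplus_le_compat_r, Rabs_sumR.
    - rewrite Rmult_plus_distr_l, <- sumR_scal.
      (* At [l = 0] the bracket contains the arbitrary value [a i 0] where [bi] has 0; the weight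
         [fall3 0 = 0] removes the discrepancy. *)
      destruct l as [|l].
      + assert (Z3 : fall3 0 = 0) by (unfold fall3; simpl; field).
        rewrite Z3, !Rmult_0_l, Rmult_0_r.
        apply Rplus_le_compat_r. apply sumR_le. intros i _. unfold w3. simpl. lra.
      + apply Rplus_le_compat.
        * right. apply sumR_ext. intros i _. reflexivity.
        * right. rewrite vlog_coeff. unfold padd. rewrite conv_C. unfold geom. simpl pC.
          rewrite Rplus_0_l, Rabs_mult. fold q qh.
          rewrite (Rabs_pos_eq (qh ^ S l)) by (apply pow_le; lra). ring. }
  assert (Hb : ex_series (fun l => fall3 l * Rabs (b l))).
  { apply (ex_series_tail_le _ _ O) with (2 := ex_intro _ _ SBd). exact Hdom. }
  destruct (third_order_factor b Hb Sb0 Sb1 Sb2) as [Q [EQ [LQ NQ]]].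
  assert (NQ' : norm1 Q <= Bd).
  { apply Rle_trans with (1 := NQ). rewrite <- (is_series_unique _ _ SBd).
    apply Series_le; [exact Hdom | eexists; exact SBd]. }
  destruct (second_difference_bound n f Hpmf HPsi) as [L2 N2]. fold Psi y in L2, N2.
  set (F := (((1 - pX) * (1 - pX) * y) * Q)%fps).
  destruct (l1_mult _ _ L2 LQ) as [LF NF]. fold F in LF, NF.
  assert (EF : ((1 - pC q * pX) * pderiv y = vlog al p ph * y + (1 - pX) * F)%fps).
  { rewrite Eb, EQ at 1. unfold F. ring. }
  pose proof (tv_bound_nb al p ph Hal Hp Hph y F Ly (proj2 Hy) LF EF) as T1.
  pose proof (tv_bound_geom al p ph Hal Hp Hph y F Ly (proj2 Hy) LF EF) as T2.
  set (D := (y - nb_pmf al p * ge_pmf ph)%fps) in *.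
  destruct (D_l1 al p ph Hal Hp Hph y Ly (proj2 Hy)) as [LD _]. fold D in LD.
  pose proof (norm1_ge0 _ LD) as ND. pose proof (norm1_ge0 _ LF) as NF0.
  assert (Hr' : 0 < r * q - Rabs (qh - q) * qh / ph ^ 2) by lra.
  pose proof (combine_bounds al p ph (norm1 D / 2) (norm1 F) Hal Hp Hph ltac:(lra) NF0 T1 T2 Hr') as T3.
  fold q qh r in T3.
  set (C := r * q - Rabs (qh - q) * qh / ph ^ 2) in *.
  replace (dTV y (conv (nb_pmf al p) (ge_pmf ph))) with (norm1 D / 2)
    by (unfold dTV, Rdiv; rewrite Rmult_comm; reflexivity).
  assert (HF : norm1 F <= 16 / 3 / Psi * Bd).
  { apply Rle_trans with (1 := NF). apply Rmult_le_compat; auto using norm1_ge0. }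
  apply Rmult_le_reg_r with C; auto.
  match goal with |- _ <= _ * ?e * C => change e with Bd end.
  replace (16 / (Psi * C) * Bd * C) with (3 * (16 / 3 / Psi * Bd)) by (field; lra).
  lra.
Qed.
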